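(* Let $(X,\tau,d)$ be an extended metric-topological space. For a Borel function $\xi:X\to\mathbb R$ with $\xi>-1/2$ put $$\mathscr P_1\xi(x)=\inf_{x'\in X}\left(\frac{\xi(x')}{1+2\xi(x')}+\frac{\sin^2(d_{\pi/2}(x,x'))}{2(1+2\xi(x'))}\right)=\inf_{x'\in X}\frac12\left(1-\frac{\cos^2(d_{\pi/2}(x,x'))}{1+2\xi(x')}\right).$$ (i) If $\xi$ is a bounded Borel function with $\inf_X\xi>-1/2$, then $\mathscr P_1\xi\in\mathrm{Lip}_b(X)$, $\sup_X\mathscr P_1\xi<1/2$, and $$\mathscr P_1\xi(x)=\inf_{x'\in B_{\pi/2}(x)}\frac12\left(1-\frac{\cos^2(d_{\pi/2}(x,x'))}{1+2\xi(x')}\right).$$ In particular, if $\xi$ has bounded support then $\mathscr P_1\xi\in\mathrm{Lip}_{bs}(X)$. (ii) Suppose that $(X,d)$ is a separable metric space and $\tau$ is induced by $d$. For every $\mu_0,\mu_1\in\mathcal M(X)$, $$\frac12\mathsf{HK}^2(\mu_0,\mu_1)=\sup\Big\{\int\mathscr P_1\xi\,d\mu_1-\int\xi\,d\mu_0:\ \xi\in\mathrm{Lip}_{bs}(X),\ \inf_X\xi>-1/2\Big\}.$$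
   Context: An extended metric-topological space $(X,\tau,d)$ is a Hausdorff space $(X,\tau)$ with an extended distance $d:X\times X\to[0,\infty]$ lower semicontinuous w.r.t. $\tau$. $d_a=\min(d,a)$; $B_{\pi/2}(x)=\{x':d(x,x')<\pi/2\}$. $\mathrm{Lip}_b(X)$ (resp. $\mathrm{Lip}_{bs}(X)$) is the set of bounded (resp. bounded with bounded support) real functions on $X$ that are Lipschitz w.r.t. $d$. $\mathcal M(X)$ is the set of finite nonnegative Radon measures on $X$. Hellinger-Kantorovich distance: the cone $\mathfrak C$ is the quotient of $X\times[0,\infty)$ identifying all points $(x,0)$ to the vertex $\mathfrak o$; $d_{\mathfrak C}^2([x_1,r_1],[x_2,r_2])=r_1^2+r_2^2-2r_1r_2\cos(d_\pi(x_1,x_2))$; when $\tau$ is induced by $d$, $\mathfrak C$ carries the topology of $d_{\mathfrak C}$. $\mathsf r([x,r])=r$, $\mathsf x([x,r])=x$ if $r>0$, $\mathsf x(\mathfrak o)=\bar x$ a fixed point; on $\mathfrak C\times\mathfrak C$, $\mathsf x_i,\mathsf r_i$ refer to the $i$-th component. For a finite Radon measure $\alpha$ on $\mathfrak C\times\mathfrak C$ with $\int(\mathsf r_1^2+\mathsf r_2^2)\,d\alpha<\infty$, $\mathfrak h_i\alpha=(\mathsf x_i)_\sharp(\mathsf r_i^2\alpha)$. Then $\mathsf{HK}^2(\mu_1,\mu_2)=\min\{\int d_{\mathfrak C}^2\,d\alpha:\mathfrak h_1\alpha=\mu_1,\ \mathfrak h_2\alpha=\mu_2\}$ over such $\alpha$.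 *)

(* Defs.v *)
From HB Require Import structures.
From mathcomp Require Import all_boot all_order all_algebra.
From mathcomp Require Import all_classical all_reals all_analysis.

Set Implicit Arguments.
Unset Strict Implicit.
Unset Printing Implicit Defensive.

Import Order.TTheory GRing.Theory Num.Theory.
Import numFieldNormedType.Exports.

Local Open Scope classical_set_scope.
Local Open Scope ring_scope.
Local Open Scope quotient_scope.

(* Measurable types are pointed in the library, hence [ptopologicalType]: the
   space is nonempty. Its (arbitrary) [point] also serves as the base point
   assigned to the vertex of the cone. *)

Section extended_metric_topological.
Context {R : realType} {X : ptopologicalType}.
Implicit Types (d : X -> X -> \bar R) (f : X -> R) (A : set X).

Record ext_metric_topological d : Prop := {
  emt_hausdorff : hausdorff_space X ;
  emt_ge0 : forall x y, (0 <= d x y)%E ;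
  emt_eq0 : forall x y, d x y = 0%E <-> x = y ;
  emt_sym : forall x y, d x y = d y x ;
  emt_triangle : forall x y z, (d x z <= d x y + d y z)%E ;
  emt_lsc : lower_semicontinuous (fun z : X * X => d z.1 z.2) }.

Definition dtrunc d (a : R) (x y : X) : R := fine (Order.min (d x y) a%:E).

Definition dball d (x : X) (r : R) : set X := [set y | (d x y < r%:E)%E].

Definition induced_by d : Prop := forall U : set X, open U <->
  forall x, U x -> exists2 e : R, 0 < e & dball d x e `<=` U.

Definition separable_metric d : Prop :=
  (forall x y, (d x y < +oo)%E) /\ exists2 D : set X, countable D & dense D.

Definition dbounded d A : Prop :=
  exists M : R, forall x y, A x -> A y -> (d x y <= M%:E)%E.

Definition bounded_support d f : Prop :=
  dbounded d (closure [set x | f x != 0]).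

Definition dlipschitz d f : Prop :=
  exists2 L : R, 0 <= L & forall x y, (`|f x - f y|%:E <= L%:E * d x y)%E.

Definition Lip_b d : set (X -> R) := [set f | bounded_fun f /\ dlipschitz d f].

Definition Lip_bs d : set (X -> R) := Lip_b d `&` bounded_support d.

(* Valued in \bar R, since the infimum can be -oo when inf xi = -1/2. *)
Definition P1 d (xi : X -> R) (x : X) : \bar R :=
  ereal_inf (range (fun x' =>
    (xi x' / (1 + 2 * xi x')
     + sin (dtrunc d (pi / 2) x x') ^+ 2 / (2 * (1 + 2 * xi x')))%:E)).

End extended_metric_topological.

Notation borel T := (g_sigma_algebraType (@open T)).

Definition borel_fun {R : realType} {X : ptopologicalType} (f : X -> R) : Prop :=
  measurable_fun setT (f : borel X -> R).

Definition radon {R : realType} {T : ptopologicalType}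
    (mu : {finite_measure set (borel T) -> \bar R}) : Prop :=
  forall A : set (borel T), measurable A -> forall e : R, 0 < e ->
  exists K : set T, [/\ compact K, K `<=` A & (mu (A `\` K) < e%:E)%E].

Section cone.
Context {R : realType} {X : ptopologicalType}.

Definition cone_rel (p q : X * {nonneg R}) : bool :=
  (p == q) || ((p.2%:num == 0) && (q.2%:num == 0)).

Lemma cone_rel_refl : reflexive cone_rel.
Proof. by move=> p; rewrite /cone_rel eqxx. Qed.

Lemma cone_rel_sym : symmetric cone_rel.
Proof. by move=> p q; rewrite /cone_rel eq_sym andbC. Qed.

Lemma cone_rel_trans : transitive cone_rel.
Proof.
move=> q p r; rewrite /cone_rel => /orP[/eqP->//|/andP[p0 q0]].
by move=> /orP[/eqP<-|/andP[_ r0]]; rewrite p0 ?q0 ?r0 orbT.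
Qed.

Canonical cone_equiv :=
  EquivRel cone_rel cone_rel_refl cone_rel_sym cone_rel_trans.

(* [d] is only used by the topology put on the quotient *)
Definition cone (d : X -> X -> \bar R) : Type := {eq_quot cone_equiv}.

Context (d : X -> X -> \bar R).

HB.instance Definition _ := Choice.on (cone d).

Definition cone_pt (x : X) (r : {nonneg R}) : cone d :=
  \pi_({eq_quot cone_equiv}) (x, r).

HB.instance Definition _ := isPointed.Build (cone d) (cone_pt point 0%:nng).

Definition cone_rep (p : cone d) : X * {nonneg R} :=
  repr (p : {eq_quot cone_equiv}).

Definition cone_rad (p : cone d) : R := (cone_rep p).2%:num.

Definition cone_base (p : cone d) : X :=
  if 0 < cone_rad p then (cone_rep p).1 else point.

Definition cone_dist (p q : cone d) : R :=
  Num.sqrt (cone_rad p ^+ 2 + cone_rad q ^+ 2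
    - 2 * cone_rad p * cone_rad q * cos (dtrunc d pi (cone_base p) (cone_base q))).

Lemma cone_rep_pt (x : X) (r : {nonneg R}) : cone_rel (cone_rep (cone_pt x r)) (x, r).
Proof. by apply/eqmodP; rewrite reprK. Qed.

Lemma cone_ptE (x y : X) (r s : {nonneg R}) :
  cone_pt x r = cone_pt y s <-> cone_rel (x, r) (y, s).
Proof. by split=> /eqmodP. Qed.

Lemma cone_rad_pt x r : cone_rad (cone_pt x r) = r%:num.
Proof.
rewrite /cone_rad; have /orP[/eqP->//|/andP[/eqP-> /eqP]] := cone_rep_pt x r.
by [].
Qed.

Lemma cone_base_pt x r : 0 < r%:num -> cone_base (cone_pt x r) = x.
Proof.
move=> r0; rewrite /cone_base cone_rad_pt r0.
have /orP[/eqP->//|/andP[_ /=]] := cone_rep_pt x r.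
by rewrite gt_eqF.
Qed.

Lemma cone_base_vertex x : cone_base (cone_pt x 0%:nng) = point.
Proof. by rewrite /cone_base cone_rad_pt /= ltxx. Qed.

Lemma cone_dist_pt x y r s : cone_dist (cone_pt x r) (cone_pt y s) =
  Num.sqrt (r%:num ^+ 2 + s%:num ^+ 2
    - 2 * r%:num * s%:num * cos (dtrunc d pi x y)).
Proof.
rewrite /cone_dist !cone_rad_pt.
have [r0|r0] := ltP 0 r%:num; last first.
  have -> : r%:num = 0 by apply/eqP; rewrite eq_le r0 /=.
  by rewrite !(mulr0, mul0r).
have [s0|s0] := ltP 0 s%:num; last first.
  have -> : s%:num = 0 by apply/eqP; rewrite eq_le s0 /=.
  by rewrite !(mulr0, mul0r).
by rewrite !cone_base_pt.
Qed.

Definition cone_open : set_system (cone d) := [set U | forall p, U p ->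
  exists2 e : R, 0 < e & [set q | cone_dist p q < e] `<=` U].

Lemma cone_openT : cone_open setT.
Proof. by move=> p _; exists 1. Qed.

Lemma cone_openI : setI_closed cone_open.
Proof.
move=> U V oU oV p [/oU[e e0 eU] /oV[f f0 fV]].
exists (Num.min e f); first by rewrite lt_min e0.
by move=> q /=; rewrite lt_min => /andP[/eU Uq /fV].
Qed.

Lemma cone_open_bigcup (I : Type) (f : I -> set (cone d)) :
  (forall i, cone_open (f i)) -> cone_open (\bigcup_i f i).
Proof.
by move=> of_ p [i _ /of_[e e0 ef]]; exists e => // q /ef; exists i.
Qed.

HB.instance Definition _ := isOpenTopological.Build (cone d)
  cone_openT cone_openI cone_open_bigcup.

Lemma cone_openE : @open (cone d) = cone_open.
Proof. by []. Qed.

End cone.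

Arguments cone_pt {R X} d x r.

HB.instance Definition _ (S T : ptopologicalType) := Pointed.on (S * T)%type.

Section hellinger_kantorovich.
Context {R : realType} {X : ptopologicalType} (d : X -> X -> \bar R).

Let CC : ptopologicalType := (cone d * cone d)%type.

Implicit Types (alpha : {finite_measure set (borel CC) -> \bar R}).

Definition homogeneous_marginal1 alpha : set (borel X) -> \bar R :=
  pushforward
    (fun B => \int[alpha]_(z in B) (cone_rad z.1 ^+ 2)%:E)%E
    (fun z : borel CC => cone_base z.1 : borel X).

Definition homogeneous_marginal2 alpha : set (borel X) -> \bar R :=
  pushforward
    (fun B => \int[alpha]_(z in B) (cone_rad z.2 ^+ 2)%:E)%E
    (fun z : borel CC => cone_base z.2 : borel X).

Definition HK_admissible (mu1 mu2 : {finite_measure set (borel X) -> \bar R})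
    alpha : Prop :=
  [/\ radon alpha,
      (\int[alpha]_z (cone_rad z.1 ^+ 2 + cone_rad z.2 ^+ 2)%:E < +oo)%E,
      (forall A, measurable A -> homogeneous_marginal1 alpha A = mu1 A) &
      (forall A, measurable A -> homogeneous_marginal2 alpha A = mu2 A)].

(* The value of the minimization problem; attainment is not part of the
   definition. *)
Definition HK2 (mu1 mu2 : {finite_measure set (borel X) -> \bar R}) : \bar R :=
  ereal_inf [set (\int[alpha]_z (cone_dist z.1 z.2 ^+ 2)%:E)%E |
    alpha in HK_admissible mu1 mu2].

End hellinger_kantorovich.

(* Main.v *)
From HB Require Import structures.
Require Import Defs.
From mathcomp Require Import all_boot all_order all_algebra.
From mathcomp Require Import all_classical all_reals all_analysis.
From mathcomp Require Import measurable_realfun.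
From mathcomp Require Import ring lra.
Import Order.TTheory GRing.Theory Num.Theory.
Import numFieldNormedType.Exports.
Local Open Scope classical_set_scope.
Local Open Scope ring_scope.

Set Implicit Arguments.
Unset Strict Implicit.
Unset Printing Implicit Defensive.

(** The theorem has an elementary part, the regularity of [P1], and a duality
    formula.

    Since [sin ^ 2 = 1 - cos ^ 2], the two expressions of [P1 xi] agree
    ([P1E]). If [1 + 2 xi >= k > 0], each function
    [x |-> (1 - cos ^ 2 d(x, x') / (1 + 2 xi x')) / 2] is Lipschitz with constant
    [k^-1], hence so is the infimum; taking [x' = x] bounds it away from [1 / 2];
    and a point at distance at least [pi / 2] only contributes [1 / 2], the largest
    possible value, so that the infimum is local and the support grows by at most
    [pi / 2] ([P1_regularity]).

    The inequality [>=] of the duality formula is a pointwise one on pairs of points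
    of the cone: completing a square,
    [P1 xi (x2) r2 ^ 2 - xi (x1) r1 ^ 2 <= d_C ^ 2 / 2] ([P1_cone_bound]), and
    integrating against a plan turns the left side into
    [\int P1 xi dmu1 - \int xi dmu0] ([weak_duality]).

    For the converse, the problem is a finite one up to an arbitrarily small
    error. Both measures are cut
    into finitely many cells of small diameter that carry almost all the mass
    ([cells_exist]). With [c i j] the cosine of the distance between the cells [i]
    and [j], and [m], [n] their masses, the finite problem is to minimize
    [\sum m u + \sum n v] over [u, v > 0] with [c i j ^ 2 <= u i v j]. A maximizer
    of a logarithmic barrier gives an almost optimal [u], [v] and, through its
    stationarity equations, masses [a i j], [b i j] with marginals at most [m], [n]
    and with [2 \sum c sqrt (a b)] almost equal to the minimum
    ([finite_duality]).

    The masses give a plan on the cone: [a i j] is transported onto [b i j] by a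
    product of restricted measures put at two fixed radii, at cost
    [a + b - 2 c sqrt (a b)], and all the mass left is sent to the vertex
    ([HK2_le_cells]). Such product plans are Radon because products of inner
    regular finite measures are ([product_inner_regular]). The potentials give an
    admissible [xi]: the function [1 + 2 xi] is a maximum of finitely many Lipschitz
    bumps built from [v], at most [u i] on the cell [i] up to a small constant, and
    such that [1 - 2 P1 xi] is at most [v j] on the cell [j] ([dual_weight],
    [dual_value]). The two values differ by the gap of the finite problem and by
    errors tending to zero with the size of the cells ([duality_gap]). *)


(** * Trigonometric estimates and the truncated distance *)

Section cosine.
Context {R : realType}.
Implicit Types x y : R.

Lemma cos_lipschitz x y : `|cos x - cos y| <= `|x - y|.
Proof.
wlog xy : x y / x <= y => [hw|].
  by case: (leP x y) => [/hw//|/ltW/hw]; rewrite distrC [leRHS]distrC.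
have dcos t : t \in `]x, y[ -> is_derive t 1 cos (- sin t).
  by move=> _; exact: is_derive_cos.
have ccos : {within `[x, y], continuous cos}.
  by apply: continuous_subspaceT => t; exact: continuous_cos.
have [c _ h] := MVT_segment xy dcos ccos.
rewrite distrC h normrM normrN [`|x - y|]distrC ler_piMl//.
exact: sin_max.
Qed.

Lemma cos_antitone x y : 0 <= x -> x <= y -> y <= pi -> cos y <= cos x.
Proof.
move=> x0; rewrite le_eqVlt => /predU1P[->//|xy] ypi.
apply/ltW; rewrite ltr_cos// in_itv /= ?x0 ?(ltW (lt_le_trans xy ypi))//.
by rewrite ypi (le_trans x0 (ltW xy)).
Qed.

End cosine.

Section truncated_distance.
Context {R : realType} {X : ptopologicalType} {d : X -> X -> \bar R}.
Hypothesis hd : ext_metric_topological d.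
Context {a : R}.
Hypothesis a0 : 0 <= a.
Implicit Types x y z : X.

Lemma dtruncE x y : ((dtrunc d a x y)%:E = Order.min (d x y) a%:E)%E.
Proof.
rewrite /dtrunc fineK// fin_numE; have := emt_ge0 hd x y.
by rewrite minEle; case: ifPn => //; case: (d x y).
Qed.

Lemma dtrunc_ge0 x y : 0 <= dtrunc d a x y.
Proof. by rewrite -lee_fin dtruncE le_min (emt_ge0 hd) lee_fin. Qed.

Lemma dtrunc_le x y : dtrunc d a x y <= a.
Proof. by rewrite -lee_fin dtruncE ge_min lexx orbT. Qed.

Lemma dtrunc_le_dist x y : ((dtrunc d a x y)%:E <= d x y)%E.
Proof. by rewrite dtruncE ge_min lexx. Qed.

Lemma dtrunc_sym x y : dtrunc d a x y = dtrunc d a y x.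
Proof. by rewrite /dtrunc (emt_sym hd). Qed.

Lemma dtruncxx x : dtrunc d a x x = 0.
Proof.
apply/eqP; rewrite eq_le dtrunc_ge0 andbT -lee_fin.
by apply: (le_trans (dtrunc_le_dist x x)); rewrite (emt_eq0 hd x x).2.
Qed.

Lemma dtrunc_far x y : (a%:E <= d x y)%E -> dtrunc d a x y = a.
Proof. by move=> h; apply: EFin_inj; rewrite dtruncE min_r. Qed.

Lemma dtrunc_triangle x y z : dtrunc d a x z <= dtrunc d a x y + dtrunc d a y z.
Proof.
rewrite -lee_fin EFinD !dtruncE.
have [xy|xy] := leP (d x y) a%:E; last first.
  rewrite ge_min; apply/orP; right; rewrite leeDl//.
  by rewrite le_min (emt_ge0 hd) lee_fin.
have [yz|yz] := leP (d y z) a%:E; last first.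
  rewrite ge_min; apply/orP; right; rewrite leeDr//.
  exact: (emt_ge0 hd).
by rewrite ge_min (emt_triangle hd).
Qed.

Lemma dtrunc_dist x y z : `|dtrunc d a x z - dtrunc d a y z| <= dtrunc d a x y.
Proof.
rewrite ler_norml; apply/andP; split.
  rewrite lerBrDr addrC lerBlDr addrC (dtrunc_sym x y).
  by rewrite dtrunc_triangle.
by rewrite lerBlDr dtrunc_triangle.
Qed.

End truncated_distance.

(** * The operator P1 *)

Section hopf_lax.
Context {R : realType} {X : ptopologicalType} {d : X -> X -> \bar R}.
Hypothesis hd : ext_metric_topological d.
Implicit Types (xi : X -> R) (x y : X).

Local Notation c x y := (cos (dtrunc d (pi / 2) x y)).

Let pi2_ge0 : 0 <= (pi / 2 : R).
Proof. by rewrite divr_ge0// pi_ge0. Qed.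

Lemma cos_dtrunc_ge0 x y : 0 <= c x y.
Proof.
apply: cos_ge0_pihalf; rewrite (dtrunc_le hd)// andbT.
by rewrite (le_trans _ (dtrunc_ge0 hd pi2_ge0 _ _))// oppr_le0.
Qed.

Definition P1_cost xi x x' : R := 1 / 2 * (1 - c x x' ^+ 2 / (1 + 2 * xi x')).

Lemma P1E xi : (forall x, - (1 / 2) < xi x) ->
  forall x, P1 d xi x = ereal_inf (range (fun x' => (P1_cost xi x x')%:E)).
Proof.
move=> h x; rewrite /P1; congr ereal_inf.
apply: eq_imagel => x' _; congr EFin.
rewrite /P1_cost sin2cos2; have := h x'; set u := xi x'; set v := cos _.
by move=> hu; field; apply: lt0r_neq0; lra.
Qed.

(** The infimum is taken in the reals because [P1 d xi] is finite as soon as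
    [1 + 2 xi] is bounded away from zero. *)
Definition P1_real xi x : R := inf (range (P1_cost xi x)).

Lemma inf_gt_lbound xi : ((- (1 / 2))%:E < ereal_inf (range (EFin \o xi)))%E ->
  exists2 k : R, 0 < k & forall x, k <= 1 + 2 * xi x.
Proof.
move=> h.
have [r hr rE] : exists2 r : R, - (1 / 2) < r & forall x, r <= xi x.
  have := h; have : (ereal_inf (range (EFin \o xi)) <= (xi point)%:E)%E.
    by apply: ereal_inf_lbound; exists point.
  case E: (ereal_inf _) => [r| |] // _; rewrite lte_fin => hr; exists r => // x.
  by rewrite -lee_fin -E; apply: ereal_inf_lbound; exists x.
by exists (1 + 2 * r) => [|x]; [lra|have := rE x; lra].
Qed.

Lemma lbound_inf_gt xi k : 0 < k -> (forall x, k <= 1 + 2 * xi x) ->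
  ((- (1 / 2))%:E < ereal_inf (range (EFin \o xi)))%E.
Proof.
move=> k0 h; apply: (@lt_le_trans _ _ ((k - 1) / 2)%:E).
  by rewrite lte_fin; lra.
apply: le_ereal_inf_tmp => _ [x _ <-] /=; rewrite lee_fin; have := h x; lra.
Qed.

Section lower_bounded.
Context {xi : X -> R} {k : R}.
Hypothesis k0 : 0 < k.
Hypothesis kxi : forall x, k <= 1 + 2 * xi x.

Let w0 x : 0 < 1 + 2 * xi x.
Proof. exact: lt_le_trans (kxi x). Qed.

Lemma P1_cost_le x x' : P1_cost xi x x' <= 1 / 2.
Proof.
rewrite /P1_cost ler_piMr// gerBl.
by rewrite divr_ge0// ?sqr_ge0// ltW.
Qed.

Lemma P1_cost_ge x x' : 1 / 2 * (1 - k^-1) <= P1_cost xi x x'.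
Proof.
rewrite /P1_cost ler_wpM2l// lerB// ler_pdivrMr// [leRHS]mulrC.
apply: (@le_trans _ _ 1); last by rewrite ler_pdivlMr// mul1r.
by rewrite expr_le1// ?cos_le1// cos_dtrunc_ge0.
Qed.

Lemma P1_cost_has_inf x : has_inf (range (P1_cost xi x)).
Proof.
split; first by exists (P1_cost xi x x), x.
by exists (1 / 2 * (1 - k^-1)) => _ [x' _ <-]; exact: P1_cost_ge.
Qed.

Lemma P1_realE x : P1 d xi x = (P1_real xi x)%:E.
Proof.
rewrite P1E; last by move=> y; have := w0 y; lra.
have [h1 h2] := P1_cost_has_inf x.
rewrite -ereal_inf_EFin//; congr ereal_inf.
by rewrite image_comp.
Qed.

Lemma P1_real_lbound x x' : P1_real xi x <= P1_cost xi x x'.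
Proof. by apply: ge_inf; [exact: (P1_cost_has_inf x).2|exists x']. Qed.

Lemma P1_real_glb x (u : R) : (forall x', u <= P1_cost xi x x') -> u <= P1_real xi x.
Proof.
move=> h; apply: lb_le_inf; first exact: (P1_cost_has_inf x).1.
by move=> _ [x' _ <-].
Qed.

Lemma P1_real_bound x : `|P1_real xi x| <= 1 / 2 + 1 / 2 * k^-1.
Proof.
have h1 := P1_real_glb (P1_cost_ge x).
have h2 := le_trans (P1_real_lbound x x) (P1_cost_le x x).
have k1 : 0 < k^-1 by rewrite invr_gt0.
rewrite ler_norml; lra.
Qed.

Lemma P1_real_le_diag x : P1_real xi x <= 1 / 2 * (1 - (1 + 2 * xi x)^-1).
Proof.
suff -> : 1 / 2 * (1 - (1 + 2 * xi x)^-1) = P1_cost xi x x.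
  exact: P1_real_lbound.
by rewrite /P1_cost (dtruncxx hd pi2_ge0) cos0 expr1n !div1r.
Qed.

(** An infimum of functions with a common Lipschitz constant inherits it, so
    the point [x'] can be frozen. The constant is that of [cos ^ 2], namely [2],
    times the bound [k^-1 / 2] on the remaining factor. *)
Lemma P1_cost_lipschitz x y x' :
  P1_cost xi x x' <= P1_cost xi y x' + k^-1 * dtrunc d (pi / 2) x y.
Proof.
rewrite /P1_cost; set w := 1 + 2 * _; set p := c x x'; set q := c y x'.
have hpq : q ^+ 2 - p ^+ 2 <= 2 * dtrunc d (pi / 2) x y.
  have h1 : `|q - p| <= dtrunc d (pi / 2) x y.
    apply: (le_trans (cos_lipschitz _ _)); rewrite distrC.
    exact: dtrunc_dist.
  have h2 : 0 <= q + p <= 2.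
    rewrite addr_ge0 ?cos_dtrunc_ge0//=.
    have := cos_le1 (dtrunc d (pi / 2) x x').
    have := cos_le1 (dtrunc d (pi / 2) y x'); rewrite -/p -/q; lra.
  rewrite subr_sqr; apply: (le_trans (ler_norm _)).
  rewrite normrM mulrC ler_pM// ger0_norm//; by case/andP: h2.
have w1 : 0 < w by exact: w0.
have kw : w^-1 <= k^-1 by rewrite lef_pV2 ?posrE//; exact: kxi.
have D0 : 0 <= dtrunc d (pi / 2) x y by exact: dtrunc_ge0.
have : (q ^+ 2 - p ^+ 2) / w <= 2 * dtrunc d (pi / 2) x y * k^-1.
  apply: (@le_trans _ _ (2 * dtrunc d (pi / 2) x y / w)).
    by rewrite ler_wpM2r// invr_ge0 ltW.
  by rewrite ler_wpM2l// mulr_ge0.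
rewrite mulrBl; lra.
Qed.

Lemma P1_real_lipschitz x y :
  `|P1_real xi x - P1_real xi y| <= k^-1 * dtrunc d (pi / 2) x y.
Proof.
have h u v : P1_real xi u <= P1_real xi v + k^-1 * dtrunc d (pi / 2) u v.
  rewrite -lerBlDr; apply: P1_real_glb => x'; rewrite lerBlDr.
  exact: le_trans (P1_real_lbound u x') (P1_cost_lipschitz _ _ _).
rewrite ler_norml lerBlDl h andbT lerBrDr addrC lerBlDl addrC.
by rewrite dtrunc_sym// h.
Qed.

Lemma P1_real_Lip_b : Lip_b d (P1_real xi).
Proof.
split.
  exists (1 / 2 + 1 / 2 * k^-1); split; first by rewrite num_real.
  by move=> M hM x _; apply: le_trans (P1_real_bound x) (ltW hM).
exists k^-1; first by rewrite invr_ge0 ltW.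
move=> x y; apply: (@le_trans _ _ (k^-1%:E * (dtrunc d (pi / 2) x y)%:E)%E).
  by rewrite -EFinM lee_fin P1_real_lipschitz.
by rewrite lee_wpmul2l// ?lee_fin ?invr_ge0 ?(ltW k0)// dtrunc_le_dist.
Qed.

(** Since [cos (pi / 2) = 0], points at distance at least [pi / 2] contribute
    [1 / 2], an upper bound of the whole cost: discarding them does not change
    the infimum. *)
Lemma P1_cost_far x x' : ~ dball d x (pi / 2) x' -> P1_cost xi x x' = 1 / 2.
Proof.
rewrite /dball /= => /negP; rewrite -leNgt => /(dtrunc_far hd) E.
by rewrite /P1_cost E cos_pihalf expr0n/= mul0r subr0 mulr1.
Qed.

Lemma P1_ball x : P1 d xi x =
  ereal_inf ((fun x' => (P1_cost xi x x')%:E) @` dball d x (pi / 2)).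
Proof.
rewrite P1E; last by move=> y; have := w0 y; lra.
apply/eqP; rewrite eq_le; apply/andP; split.
  by apply: ereal_inf_le_tmp => _ [y _ <-]; exists y.
apply: le_ereal_inf_tmp => _ [x' _ <-].
have [bx|/P1_cost_far ->] := pselect (dball d x (pi / 2) x').
  by apply: ereal_inf_lbound; exists x'.
apply: (@le_trans _ _ (P1_cost xi x x)%:E); last by rewrite lee_fin P1_cost_le.
apply: ereal_inf_lbound; exists x => //.
by rewrite /dball/= (emt_eq0 hd x x).2// lte_fin divr_gt0// pi_gt0.
Qed.

(** Points outside the ball contribute [1 / 2], those inside contribute
    [(1 - cos ^ 2) / 2], and the centre contributes [0]. Hence [P1 xi] vanishes
    beyond distance [pi / 2] from the support of [xi]. *)
Lemma P1_real_eq0 x : (forall x', dball d x (pi / 2) x' -> xi x' = 0) ->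
  P1_real xi x = 0.
Proof.
move=> h; have xix : xi x = 0.
  by apply: h; rewrite /dball/= (emt_eq0 hd x x).2// lte_fin divr_gt0// pi_gt0.
apply/eqP; rewrite eq_le; apply/andP; split.
  by have := P1_real_le_diag x; rewrite xix mulr0 addr0 invr1 subrr mulr0.
apply: P1_real_glb => x'.
have [bx|/P1_cost_far -> //] := pselect (dball d x (pi / 2) x').
rewrite /P1_cost (h _ bx) mulr0 addr0 divr1 mulr_ge0// subr_ge0 expr_le1 ?cos_le1 ?cos_dtrunc_ge0.
Qed.

End lower_bounded.

(** The support is a closure for the topology, which [d] need not induce:
    what makes the argument work is that lower semicontinuity makes the
    superlevel sets of [d] open. *)
Lemma dbounded_closure A : dbounded d A -> dbounded d (closure A).
Proof.
move=> [M hM]; exists M => x y cx cy; rewrite leNgt; apply/negP => lt_M.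
have /lower_semicontinuousP/(_ M) oM := emt_lsc hd.
have : nbhs (x, y) [set z : X * X | (M%:E < d z.1 z.2)%E].
  by apply: open_nbhs_nbhs; split.
move=> [[U V]/= [nU nV] UV].
have [u [Au Uu]] := cx _ nU; have [v [Av Vv]] := cy _ nV.
by have := UV (u, v) (conj Uu Vv); rewrite /= ltNge hM.
Qed.

Lemma P1_real_bounded_support xi k : 0 < k -> (forall x, k <= 1 + 2 * xi x) ->
  bounded_support d xi -> bounded_support d (P1_real xi).
Proof.
move=> k0 kxi [M hM]; apply: dbounded_closure.
have near_support x : P1_real xi x != 0 ->
    exists2 s, closure [set y | xi y != 0] s & (d x s <= (pi / 2)%:E)%E.
  move=> /eqP Qx; apply: contrapT => h; apply: Qx; apply: P1_real_eq0 k0 kxi _ _.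
  move=> x' bx; apply/eqP/negPn/negP => xx; apply: h; exists x'.
    exact: subset_closure.
  exact/ltW.
exists (pi / 2 + (M + pi / 2)) => x y /near_support[s Ss ds] /near_support[t St dt].
apply: (le_trans (emt_triangle hd x s y)); rewrite !EFinD; apply: leeD => //.
apply: (le_trans (emt_triangle hd s t y)); apply: leeD; first exact: hM.
by rewrite (emt_sym hd).
Qed.

Lemma P1_regularity xi : bounded_fun xi ->
  ((- (1 / 2))%:E < ereal_inf (range (EFin \o xi)))%E ->
  [/\ exists2 f : X -> R, Lip_b d f & forall x, P1 d xi x = (f x)%:E,
      (ereal_sup (range (P1 d xi)) < (1 / 2)%:E)%E,
      forall x, P1 d xi x =
        ereal_inf ((fun x' => (P1_cost xi x x')%:E) @` dball d x (pi / 2)) &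
      bounded_support d xi ->
        exists2 f : X -> R, Lip_bs d f & forall x, P1 d xi x = (f x)%:E].
Proof.
move=> [M [Mr bM]] /inf_gt_lbound[k k0 kxi]; split.
- exists (P1_real xi); first exact: P1_real_Lip_b k0 kxi.
  exact: P1_realE k0 kxi.
(* Testing the infimum at [x' = x] already keeps it away from [1 / 2]. *)
- pose N := Num.max (M + 1) 1.
  have N0 : 0 < N by rewrite lt_max ltr01 orbT.
  have bN x : xi x <= N.
    apply: le_trans (ler_norm _) _; apply: (bM N) => //.
    by rewrite lt_max ltrDl ltr01.
  apply: (@le_lt_trans _ _ (1 / 2 * (1 - (1 + 2 * N)^-1))%:E); last first.
    rewrite lte_fin; have : 0 < (1 + 2 * N)^-1 by rewrite invr_gt0; lra.
    lra.
  apply: ge_ereal_sup => _ [x _ <-]; rewrite (P1_realE k0 kxi) lee_fin.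
  apply: (le_trans (P1_real_le_diag k0 kxi x)).
  rewrite ler_wpM2l// lerB// lef_pV2 ?posrE.
  + by have := bN x; lra.
  + lra.
  + by have := kxi x; lra.
- exact: P1_ball k0 kxi.
- move=> bs; exists (P1_real xi); last exact: P1_realE k0 kxi.
  by split; [exact: P1_real_Lip_b k0 kxi|exact: P1_real_bounded_support k0 kxi _].
Qed.

End hopf_lax.


(** * Finite duality by a logarithmic barrier *)

Section barrier_tools.
Context {R : realType}.

(** The Weierstrass product inequality, in which the [1 + h * s k] may lie on
    either side of [1]. It bounds the increment of a product of affine factors
    from below by the linear part of its expansion. *)
Lemma prod_1D_ge (T : finType) (h : R) (s : T -> R) :
  (forall k, 0 <= s k) -> (forall k, 0 <= 1 + h * s k) ->
  1 + h * \sum_k s k <= \prod_k (1 + h * s k).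
Proof.
move=> s0 hs; pose Q (x y : R) := 0 <= x /\ 1 + h * x <= y.
suff [] : Q (\sum_k s k) (\prod_k (1 + h * s k)) by [].
elim/big_rec2: _ => [|k x y _ [x0 xy]]; first by rewrite /Q mulr0 addr0.
split; first by rewrite addr_ge0.
apply: (@le_trans _ _ ((1 + h * s k) * (1 + h * x))).
  have : 0 <= h ^+ 2 * (s k * x) by rewrite mulr_ge0 ?sqr_ge0 ?mulr_ge0.
  lra.
by rewrite ler_wpM2l.
Qed.

Lemma prod_le_expr (T : finType) (F : T -> R) (B : R) :
  (forall k, 0 <= F k <= B) -> \prod_k F k <= B ^+ #|T|.
Proof.
by move=> FB; rewrite -prodr_const; apply: ler_prod => k _; exact: FB.
Qed.

(** A line lying below the graph of an exponential near a common point is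
    tangent to it. *)
Lemma expR_tangent_slope (mu S h0 : R) : 0 < h0 ->
  (forall h, `|h| < h0 -> 1 + h * S <= expR (h * mu)) -> S = mu.
Proof.
move=> h00 H; pose f (h : R) := expR (h * mu) - h * S.
have df (t : R) : is_derive t (1 : R) f (expR (t * mu) * mu - S).
  apply: is_derive_eq; rewrite /GRing.scale /=; ring.
have : is_derive (0 : R) 1 f 0.
  apply: (@derive1_at_min _ f (- h0) h0 0).
  - by rewrite ge0_cp// ltW.
  - by move=> t _; have [] := df t.
  - by rewrite in_itv/= oppr_lt0 h00.
  - move=> t; rewrite in_itv/= -ltr_norml => /H; rewrite /f !mul0r expR0; lra.
move=> d0; have := @derive_val _ _ _ _ _ _ _ (df 0).
rewrite (@derive_val _ _ _ _ _ _ _ d0) mul0r expR0 mul1r => h.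
by apply/eqP; rewrite -subr_eq0 -oppr_eq0 opprB -h.
Qed.

End barrier_tools.

Section barrier.
Context {R : realType}.

(** The exponential of the logarithmic barrier
    [\sum_(i, j) ln (u i v j - c i j ^ 2) + \sum_i ln (u i) + \sum_j ln (v j)
     - (\sum_i m i u i + \sum_j n j v j) / e]
    of the problem of minimizing [\sum m u + \sum n v] under the constraints
    [c i j ^ 2 <= u i v j]. The product form, with the maximum with [0], extends
    continuously by zero to the boundary, so that maximizers exist by
    compactness and are automatically interior. *)
Definition barrier {I J : finType} (m : I -> R) (n : J -> R) (c : I -> J -> R)
    (e : R) (u : I -> R) (v : J -> R) : R :=
  (\prod_i \prod_j Num.max 0 (u i * v j - c i j ^+ 2)) *
  ((\prod_i u i) * (\prod_j v j)) *
  expR (- (\sum_i m i * u i + \sum_j n j * v j) / e).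

Lemma barrier_swap {I J : finType} (m : I -> R) (n : J -> R) c e u v :
  barrier m n c e u v = barrier n m (fun j i => c i j) e v u.
Proof.
rewrite /barrier exchange_big /= [\prod_i u i * _]mulrC [\sum_i _ + _]addrC.
congr (_ * _ * _); apply: eq_bigr => j _; apply: eq_bigr => i _.
by rewrite mulrC.
Qed.

Section stationarity.
Context {I J : finType} {m : I -> R} {n : J -> R} {c : I -> J -> R} {e : R}.
Hypothesis e0 : 0 < e.
Context {u : I -> R} {v : J -> R}.
Hypothesis u0 : forall i, 0 < u i.
Hypothesis v0 : forall j, 0 < v j.
Hypothesis uv : forall i j, c i j ^+ 2 < u i * v j.
Hypothesis umax : forall u', (forall i, 0 <= u' i) ->
  barrier m n c e u' v <= barrier m n c e u v.

(** The vanishing of the derivative in [u i] of the logarithm of the barrier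
    at a maximum. Moving [u i] by [h] multiplies the polynomial part by
    [\prod_k (1 + h * s k)], where [s] lists the logarithmic derivatives, and the
    exponential by [expR (- h * m i / e)]; maximality says that the product of
    the two is at most [1], and linearizing identifies the slopes. *)
Lemma barrier_stationary i :
  \sum_j v j / (u i * v j - c i j ^+ 2) + (u i)^-1 = m i / e.
Proof.
pose P j := u i * v j - c i j ^+ 2.
have P0 j : 0 < P j by rewrite subr_gt0.
pose s (k : option J) := if k is Some j then v j / P j else (u i)^-1.
have s0 k : 0 < s k.
  by case: k => [j|] /=; rewrite ?divr_gt0 ?invr_gt0.
pose U h k := if k == i then u i + h else u k.
pose F x := (\prod_j Num.max 0 (x * v j - c i j ^+ 2)) * x * expR (- (m i * x) / e).
pose K := (\prod_(k | k != i) \prod_j Num.max 0 (u k * v j - c k j ^+ 2)) *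
  ((\prod_(k | k != i) u k) * (\prod_j v j)) *
  expR (- (\sum_(k | k != i) m k * u k + \sum_j n j * v j) / e).
have K0 : 0 < K.
  rewrite !mulr_gt0 ?expR_gt0//; apply: prodr_gt0 => k _ //.
  by apply: prodr_gt0 => j _; rewrite lt_max subr_gt0 uv orbT.
have UE h : barrier m n c e (U h) v = K * F (u i + h).
  rewrite /barrier (bigD1 i)//= [\prod_k U h k](bigD1 i)//=.
  rewrite [\sum_k m k * U h k](bigD1 i)//= /U eqxx.
  rewrite (_ : - _ / e = - (m i * (u i + h)) / e +
    - (\sum_(k | k != i) m k * u k + \sum_j n j * v j) / e); last first.
    rewrite -mulrDl; congr (_ / e).
    rewrite (eq_bigr (fun k => m k * u k)); last by move=> k /negbTE ->.
    by rewrite -addrA opprD.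
  rewrite expRD /K /F.
  have -> : \prod_(k | k != i) \prod_j Num.max 0 ((if k == i then u i + h else u k)
      * v j - c k j ^+ 2) = \prod_(k | k != i) \prod_j Num.max 0 (u k * v j - c k j ^+ 2).
    by apply: eq_bigr => k /negbTE ->.
  have -> : \prod_(k | k != i) (if k == i then u i + h else u k) = \prod_(k | k != i) u k.
    by apply: eq_bigr => k /negbTE ->.
  ring.
have U00 : U 0 = u.
  by apply/funext => k; rewrite /U; case: eqP => [->|//]; rewrite addr0.
have Fmax h : 0 <= u i + h -> F (u i + h) <= F (u i).
  move=> h0; rewrite -(ler_pM2l K0) -UE -[u i in leRHS]addr0 -UE U00.
  by apply: umax => k; rewrite /U; case: eqP => // _; exact: ltW.
have T0 : 0 < 1 + \sum_k s k.
  by rewrite ltr_wpDr// sumr_ge0// => k _; exact: ltW.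
(* For [`|h| < h0] all the factors [1 + h * s k] are positive. *)
pose h0 := (1 + \sum_k s k)^-1.
have h00 : 0 < h0 by rewrite invr_gt0.
have hs h k : `|h| < h0 -> 0 < 1 + h * s k.
  move=> hh; have : `|h * s k| < 1.
    rewrite normrM (gtr0_norm (s0 k)).
    apply: (@lt_le_trans _ _ (h0 * s k)); first by rewrite ltr_pM2r.
    rewrite /h0 mulrC ler_pdivrMr// mul1r (bigD1 k)//=.
    rewrite addrCA lerDl addr_ge0// sumr_ge0// => k' _; exact: ltW.
  rewrite ltr_norml; lra.
rewrite addrC -[RHS](@expR_tangent_slope _ (m i / e)
  ((u i)^-1 + \sum_j v j / P j) h0)//.
move=> h hh.
have -> : (u i)^-1 + \sum_j v j / P j = \sum_k s k.
  rewrite [RHS](bigD1 None)//=; congr (_ + _).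
  rewrite (reindex_omap Some id)/=; last by case.
  by apply: eq_bigl => j; rewrite eqxx.
apply: (le_trans (prod_1D_ge _ _)) => [k|k|]; [exact: ltW|exact/ltW/hs|].
have uh : u i + h = u i * (1 + h * s None) by rewrite /= mulrDr mulr1 mulrCA divff ?mulr1// gt_eqF.
have uh0 : 0 <= u i + h by rewrite uh mulr_ge0// ltW// hs.
have := Fmax h uh0.
have E1 : \prod_j Num.max 0 ((u i + h) * v j - c i j ^+ 2) =
    \prod_j P j * \prod_j (1 + h * s (Some j)).
  rewrite -big_split/=; apply: eq_bigr => j _.
  have E : (u i + h) * v j - c i j ^+ 2 = P j * (1 + h * s (Some j)).
    have : P j != 0 by rewrite gt_eqF.
    by rewrite /= /P => ?; field.
  rewrite E max_r// mulr_ge0//; first exact: ltW.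
  by rewrite ltW// (hs h (Some j)).
have E2 : \prod_j Num.max 0 (u i * v j - c i j ^+ 2) = \prod_j P j.
  by apply: eq_bigr => j _; rewrite max_r// ltW// P0.
rewrite /F E1 E2.
have -> : expR (- (m i * (u i + h)) / e) =
    expR (- (m i * u i) / e) / expR (h * (m i / e)).
  rewrite -expRN -expRD; congr expR; field; exact: lt0r_neq0.
rewrite uh.
have -> : \prod_k (1 + h * s k) =
    (1 + h * s None) * \prod_j (1 + h * s (Some j)).
  rewrite [LHS](bigD1 None)//=; congr (_ * _).
  rewrite (reindex_omap Some id)/=; last by case.
  by apply: eq_bigl => j; rewrite eqxx.
have PP : 0 < \prod_j P j by apply: prodr_gt0.
set A := \prod_j P j in PP *; set B := \prod_j _; set E := expR (- _ / e).
set H := expR (h * _) => hle.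
have E0 : 0 < E by exact: expR_gt0.
have H0 : 0 < H by exact: expR_gt0.
have : (A * u i * E) * ((1 + h * s None) * B / H) <= (A * u i * E) * 1.
  have -> : (A * u i * E) * ((1 + h * s None) * B / H) =
    A * B * (u i * (1 + h * s None)) * (E / H) by ring.
  by rewrite mulr1.
by rewrite ler_pM2l ?mulr_gt0// ler_pdivrMr// mul1r.
Qed.

End stationarity.

Section existence.
Context {I J : finType} {m : I -> R} {n : J -> R} {c : I -> J -> R} {e : R}.
Hypothesis m0 : forall i, 0 < m i.
Hypothesis n0 : forall j, 0 < n j.
Hypothesis c0 : forall i j, 0 <= c i j.
Hypothesis e0 : 0 < e.

Local Notation G w := (barrier m n c e (w \o inl) (w \o inr)).

(** The polynomial part is at most [S ^ D] with [S] the sum of the variables,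
    while the exponential decays at least like [expR (- mu S / e)]; so the
    barrier is small at every point with a large coordinate. *)
Lemma barrier_decay : exists2 C : R, 0 < C &
  forall w : (I + J)%type -> R, (forall k, 0 <= w k) ->
    G w * \sum_k w k <= C.
Proof.
pose mn (k : (I + J)%type) := match k with inl i => m i | inr j => n j end.
have [mu mu0 mumn] : exists2 mu : R, 0 < mu & forall k, mu <= mn k.
  exists (\big[Num.min/1]_k mn k); last by move=> k; exact: bigmin_inf.
  by apply: lt_bigmin => // -[k _|k _]; [exact: m0|exact: n0].
(* [D] is the degree of the polynomial part; [L] is such that
   [expR (S / L) ^ D.+1 = expR (mu / e * S)] and dominates [(S / L) ^ D.+1]. *)
pose D := (2 * #|J| * #|I| + (#|I| + #|J|))%N.
pose L := D.+1%:R / (mu / e).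
have L0 : 0 < L by rewrite !divr_gt0// ltr0n.
exists (L ^+ D.+1); first by rewrite exprn_gt0.
move=> w w0; set S := \sum_k w k.
have S0 : 0 <= S by apply: sumr_ge0.
have wS k : w k <= S.
  by rewrite /S (bigD1 k)//= lerDl sumr_ge0.
have SD : S ^+ D.+1 <= L ^+ D.+1 * expR (mu / e * S).
  have -> : expR (mu / e * S) = expR (S / L) ^+ D.+1.
    rewrite -expRM_natl; congr expR; rewrite /L; field.
    by rewrite !lt0r_neq0//= nat1r ltr0n.
  have LE0 : 0 <= L * expR (S / L) by apply: mulr_ge0; rewrite ?expR_ge0 ?(ltW L0).
  rewrite -exprMn lerXn2r ?nnegrE//.
  rewrite mulrC -(ler_pdivrMr _ _ L0); apply: (le_trans _ (expR_ge1Dx _)).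
  by rewrite lerDr.
have Gle : G w <= S ^+ D * expR (- (mu / e * S)).
  rewrite /barrier; apply: ler_pM => //.
  - apply: mulr_ge0; last by apply: mulr_ge0; apply: prodr_ge0 => k _; exact: w0.
    by apply: prodr_ge0 => i _; apply: prodr_ge0 => j _; rewrite le_max lexx.
  - rewrite /D exprD !exprM exprD; apply: ler_pM => //.
    + by apply: prodr_ge0 => i _; apply: prodr_ge0 => j _; rewrite le_max lexx.
    + by apply: mulr_ge0; apply: prodr_ge0 => k _; exact: w0.
    + apply: prod_le_expr => i; rewrite prodr_ge0 => [|j _]; last first.
        by rewrite le_max lexx.
      apply: prod_le_expr => j; rewrite le_max lexx ge_max exprn_ge0//= lerBlDr.
      by apply: (@le_trans _ _ (S ^+ 2)); rewrite ?lerDl ?sqr_ge0// expr2 ler_pM.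
    + have Pw T (f : T -> (I + J)%type) (r : seq T) : 0 <= \prod_(k <- r) w (f k).
        by apply: prodr_ge0 => k _; exact: w0.
      by apply: ler_pM; [exact: Pw|exact: Pw|
        apply: prod_le_expr => k; rewrite /= w0 wS..].
  - rewrite ler_expR mulNr lerN2 mulrAC ler_wpM2r ?invr_ge0 ?(ltW e0)//.
    rewrite /S big_sumType/= mulrDr !mulr_sumr; apply: lerD; apply: ler_sum => k _.
      by rewrite ler_wpM2r// (mumn (inl k)).
    by rewrite ler_wpM2r// (mumn (inr k)).
apply: (@le_trans _ _ (S ^+ D * expR (- (mu / e * S)) * S)); first exact: ler_wpM2r.
rewrite mulrAC -exprSr expRN ler_pdivrMr ?expR_gt0//.
Qed.

Lemma barrier_continuous :
  continuous ((fun w => G w) : prod_topology (fun _ : (I + J)%type => R) -> R).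
Proof.
have prj k : continuous ((fun w => w k) : prod_topology (fun _ : (I + J)%type => R) -> R).
  exact: (@proj_continuous _ (fun _ => R) k).
have prod_cont : continuous (fun z : R * R => z.1 * z.2) by exact: mul_continuous.
have sum_cont : continuous (fun z : R * R => z.1 + z.2) by exact: add_continuous.
have cprod (T : finType) (F : T -> {ptws (I + J)%type -> R} -> R) :
    (forall k, continuous (F k)) -> continuous (fun w => \prod_k F k w).
  by move=> cF; exact: (@continuous_big _ _ _ _ xpredT prod_cont _ _ F (fun k _ => cF k)).
have csum (T : finType) (F : T -> {ptws (I + J)%type -> R} -> R) :
    (forall k, continuous (F k)) -> continuous (fun w => \sum_k F k w).
  by move=> cF; exact: (@continuous_big _ _ _ _ xpredT sum_cont _ _ F (fun k _ => cF k)).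
pose W := {ptws (I + J)%type -> R}.
have cM (f g : W -> R) : continuous f -> continuous g -> continuous (fun w => f w * g w).
  by move=> cf cg w; exact: (cvgM (cf w) (cg w)).
have ccst (x : R) : continuous (fun _ : W => x) by exact: (@cst_continuous W R x).
have cmax (f : W -> R) : continuous f -> continuous (fun w => Num.max 0 (f w)).
  by move=> cf w; exact: (continuous_max (ccst 0 w) (cf w)).
have cB (f : W -> R) (x : R) : continuous f -> continuous (fun w => f w - x).
  by move=> cf w; exact: (cvgB (cf w) (ccst x w)).
have c1 : continuous (fun w : W => \prod_i \prod_j
    Num.max 0 (w (inl i) * w (inr j) - c i j ^+ 2)).
  apply: (cprod _ (fun i w => \prod_j _)) => i.
  by apply: (cprod _ (fun j w => Num.max 0 _)) => j; apply: cmax; apply: cB; apply: cM.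
have c2 := cprod _ (fun i w => w (inl i)) (fun i => prj (inl i)).
have c3 := cprod _ (fun j w => w (inr j)) (fun j => prj (inr j)).
have c4 : continuous (fun w : W => expR (- (\sum_i m i * w (inl i) + \sum_j n j * w (inr j)) / e)).
  have l1 := csum _ (fun i w => m i * w (inl i)) (fun i => cM _ _ (ccst _) (prj (inl i))).
  have l2 := csum _ (fun j w => n j * w (inr j)) (fun j => cM _ _ (ccst _) (prj (inr j))).
  move=> w; apply: (@continuous_comp _ _ _ (fun w : W =>
    - (\sum_i m i * w (inl i) + \sum_j n j * w (inr j)) / e) expR); last exact: continuous_expR.
  exact: (cvgM (cvgN (cvgD (l1 w) (l2 w))) (ccst _ w)).
exact: cM _ _ (cM _ _ c1 (cM _ _ c2 c3)) c4.
Qed.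

(** By the decay estimate a maximizer over a large enough cube is a global
    one. Its value is positive, which forces every factor to be positive. *)
Lemma barrier_maximizer : exists u v, [/\ forall i, 0 < u i,
  forall j, 0 < v j, forall i j, c i j ^+ 2 < u i * v j &
  forall u' v', (forall i, 0 <= u' i) -> (forall j, 0 <= v' j) ->
    barrier m n c e u' v' <= barrier m n c e u v].
Proof.
have [C C0 decay] := barrier_decay.
(* The constant point [t] is strictly feasible: the maximum is positive. *)
pose t := 1 + \sum_i \sum_j c i j.
have t1 : 1 <= t by rewrite lerDl sumr_ge0// => i _; rewrite sumr_ge0.
have t0 : 0 < t by lra.
have ct i j : c i j < t.
  rewrite /t (bigD1 i)//= (bigD1 j)//=.
  have : 0 <= \sum_(j' | j' != j) c i j' by rewrite sumr_ge0.
  have : 0 <= \sum_(i' | i' != i) \sum_j c i' j.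
    by rewrite sumr_ge0// => ? _; rewrite sumr_ge0.
  lra.
pose w0 (_ : (I + J)%type) := t.
have Gw0 : 0 < G w0.
  rewrite /barrier !mulr_gt0 ?expR_gt0//; apply: prodr_gt0 => i _ //.
  apply: prodr_gt0 => j _; rewrite lt_max /= subr_gt0 -expr2.
  by rewrite ltrXn2r ?ct ?orbT// ltW.
pose U := Num.max t (C / G w0).
pose box : set {ptws (I + J)%type -> R} :=
  [set w | forall k, `[0, U]%classic (w k)].
have cbox : compact box.
  exact: (@tychonoff _ (fun _ => R) (fun _ => `[0, U]%classic) (fun _ => @segment_compact R 0 U)).
have boxw0 : box w0 by move=> k; rewrite /= in_itv/= (ltW t0) le_max lexx.
have [w /set_mem bw wmax] := @compact_EVT_max
  {ptws (I + J)%type -> R} R (fun w : (I + J)%type -> R => G w) box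
  (ex_intro _ w0 boxw0) cbox (continuous_subspaceT barrier_continuous).
have wge k : 0 <= w k by have := bw k; rewrite /= in_itv/= => /andP[].
have glob w' : (forall k, 0 <= w' k) -> G w' <= G w.
  move=> w'0; have [bw'|nbw'] := pselect (box w'); first by apply: wmax; exact/mem_set.
  have [k Uk] : exists k, U < w' k.
    apply: contrapT => h; apply: nbw' => k; rewrite /= in_itv/= w'0 leNgt.
    by apply/negP => ?; apply: h; exists k.
  apply: (@le_trans _ _ (G w0)); last by apply: wmax; exact/mem_set.
  have wS : w' k <= \sum_k w' k by rewrite (bigD1 k)//= lerDl sumr_ge0.
  have S0 : C / G w0 < \sum_k w' k.
    by apply: lt_le_trans wS; apply: le_lt_trans Uk; rewrite le_max lexx orbT.
  have S1 : 0 < \sum_k w' k by apply: le_lt_trans S0; rewrite divr_ge0// ltW.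
  rewrite -(ler_pM2r S1); apply: (le_trans (decay _ w'0)).
  by rewrite mulrC -ler_pdivrMr// ltW.
have Gw : 0 < G w by apply: lt_le_trans Gw0 (wmax _ _); exact/mem_set.
move: (Gw); rewrite /barrier => Gw'.
have [P1 [P2 P3]] : \prod_i \prod_j Num.max 0 (w (inl i) * w (inr j) - c i j ^+ 2) != 0
  /\ \prod_i w (inl i) != 0 /\ \prod_j w (inr j) != 0.
  move: (lt0r_neq0 Gw'); rewrite !mulf_eq0 !negb_or => /andP[/andP[-> /andP[-> ->]] _] //.
exists (w \o inl), (w \o inr); split.
- move=> i; rewrite lt_def wge andbT; move/prodf_neq0: P2 => /(_ i); exact.
- move=> j; rewrite lt_def wge andbT; move/prodf_neq0: P3 => /(_ j); exact.
- move=> i j; move/prodf_neq0: P1 => /(_ i isT) /prodf_neq0 /(_ j isT) /=.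
  by rewrite -subr_gt0; case: ltP => // _; rewrite eqxx.
- move=> u' v' u'0 v'0.
  pose w' (k : (I + J)%type) := match k with inl i => u' i | inr j => v' j end.
  by apply: (glob w') => -[].
Qed.

End existence.

(** The stationarity equations at the maximizer of the barrier provide primal
    masses: [a i j] and [b i j] are [e] times the partial derivatives of
    [ln (u i v j - c i j ^ 2)]. With [t = sqrt (u i v j)] one finds
    [a u + b v = 2 e t ^ 2 / (t ^ 2 - c ^ 2)] and
    [c sqrt (a b) = e c t / (t ^ 2 - c ^ 2)], so each pair loses at most [2 e],
    and each variable loses [e] more. *)
Lemma finite_duality {I J : finType} {m : I -> R} {n : J -> R} {c : I -> J -> R} {eta : R} :
  (forall i, 0 < m i) -> (forall j, 0 < n j) -> (forall i j, 0 <= c i j) -> 0 < eta ->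
  exists u v a b,
    [/\ (forall i, 0 < u i) /\ (forall j, 0 < v j),
        forall i j, c i j ^+ 2 <= u i * v j,
        (forall i j, 0 <= a i j) /\ (forall i j, 0 <= b i j),
        (forall i, \sum_j a i j <= m i) /\ (forall j, \sum_i b i j <= n j) &
        \sum_i m i * u i + \sum_j n j * v j <=
          2 * (\sum_i \sum_j c i j * Num.sqrt (a i j * b i j)) + eta].
Proof.
move=> m0 n0 c0 eta0.
pose D := (2 * #|J| * #|I| + (#|I| + #|J|))%N.
(* [D] counts the losses: [2 e] for each pair and [e] for each variable. *)
pose e := eta / D.+1%:R.
have e0 : 0 < e by rewrite divr_gt0// ltr0n.
have [u [v [u0 v0 uv max]]] := barrier_maximizer m0 n0 c0 e0.
have P0 i j : 0 < u i * v j - c i j ^+ 2 by rewrite subr_gt0.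
pose a i j := e * (v j / (u i * v j - c i j ^+ 2)).
pose b i j := e * (u i / (u i * v j - c i j ^+ 2)).
have a0 i j : 0 <= a i j by rewrite mulr_ge0 ?divr_ge0// ltW.
have b0 i j : 0 <= b i j by rewrite mulr_ge0 ?divr_ge0// ltW.
have aE i : \sum_j a i j + e / u i = m i.
  rewrite -mulr_sumr -mulrDr.
  rewrite (barrier_stationary e0 u0 v0 uv (fun u' h => max u' v h (fun j => ltW (v0 j)))).
  by rewrite mulrC divfK// gt_eqF.
have bE j : \sum_i b i j + e / v j = n j.
  have uv' j' i : c i j' ^+ 2 < v j' * u i by rewrite mulrC.
  have max' v' : (forall j, 0 <= v' j) ->
      barrier n m (fun j i => c i j) e v' u <= barrier n m (fun j i => c i j) e v u.
    move=> h; have := max u v' (fun i => ltW (u0 i)) h.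
    by rewrite !(barrier_swap m n c).
  have := barrier_stationary e0 v0 u0 uv' max' j.
  under eq_bigr do rewrite mulrC [v j * _]mulrC.
  move=> h; rewrite -mulr_sumr -mulrDr; under eq_bigr do rewrite mulrC.
  by rewrite h mulrC divfK// gt_eqF.
exists u, v, a, b; split => //.
- by move=> i j; exact: ltW.
- by split=> [i|j]; [rewrite -aE|rewrite -bE]; rewrite lerDl divr_ge0// ltW.
have mu i : m i * u i = \sum_j a i j * u i + e.
  by rewrite -{1}aE mulrDl divfK ?gt_eqF// mulr_suml.
have nv j : n j * v j = \sum_i b i j * v j + e.
  by rewrite -{1}bE mulrDl divfK ?gt_eqF// mulr_suml.
have gap i j : a i j * u i + b i j * v j <= 2 * (c i j * Num.sqrt (a i j * b i j)) + 2 * e.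
  pose t := Num.sqrt (u i * v j).
  have t2 : u i * v j = t ^+ 2 by rewrite sqr_sqrtr// mulr_ge0// ltW.
  have t0 : 0 <= t by exact: sqrtr_ge0.
  have ct : c i j < t.
    rewrite ltNge; apply/negP => tc; have := uv i j.
    by rewrite t2 ltNge lerXn2r ?nnegrE.
  have P1 : 0 < t ^+ 2 - c i j ^+ 2 by rewrite -t2.
  have -> : Num.sqrt (a i j * b i j) = e * t / (t ^+ 2 - c i j ^+ 2).
    rewrite /a /b t2.
    rewrite (_ : _ * _ = (e * t / (t ^+ 2 - c i j ^+ 2)) ^+ 2); last first.
      transitivity (e ^+ 2 * (u i * v j) * ((t ^+ 2 - c i j ^+ 2)^-1) ^+ 2); first by ring.
      by rewrite t2; ring.
    by rewrite sqrtr_sqr ger0_norm// !mulr_ge0 ?invr_ge0// ltW.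
  rewrite /a /b t2.
  have -> : e * (v j / (t ^+ 2 - c i j ^+ 2)) * u i +
    e * (u i / (t ^+ 2 - c i j ^+ 2)) * v j = 2 * e * t ^+ 2 / (t ^+ 2 - c i j ^+ 2).
    by rewrite -t2; field; rewrite t2 gt_eqF.
  rewrite ler_pdivrMr//.
  have -> : (2 * (c i j * (e * t / (t ^+ 2 - c i j ^+ 2))) + 2 * e) * (t ^+ 2 - c i j ^+ 2)
    = 2 * (c i j * (e * t)) + 2 * e * (t ^+ 2 - c i j ^+ 2) by field; rewrite gt_eqF.
  have : 0 <= e * (c i j * (t - c i j)).
    by rewrite mulr_ge0// ?(ltW e0)// mulr_ge0// subr_ge0 ltW.
  lra.
under eq_bigr do rewrite mu.
under [X in _ + X <= _]eq_bigr do rewrite nv.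
rewrite !big_split/= [X in _ + (X + _)]exchange_big/= addrACA -big_split/=.
have -> : eta = 2 * e * (#|J|%:R * #|I|%:R) + (e * #|I|%:R + e * #|J|%:R) + e.
  have -> : eta = e * D.+1%:R by rewrite /e divfK// lt0r_neq0// ltr0n.
  rewrite /D -natr1 !natrD !natrM; ring.
have -> : \sum_(i : I) e = e * #|I|%:R by rewrite sumr_const mulr_natr.
have -> : \sum_(j : J) e = e * #|J|%:R by rewrite sumr_const mulr_natr.
suff : \sum_i (\sum_j a i j * u i + \sum_j b i j * v j) <=
  2 * (\sum_i \sum_j c i j * Num.sqrt (a i j * b i j)) + 2 * e * (#|J|%:R * #|I|%:R).
  lra.
have -> : 2 * e * (#|J|%:R * #|I|%:R) = \sum_(i : I) \sum_(j : J) 2 * e.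
  by rewrite !sumr_const -mulrnA -natrM mulr_natr.
rewrite mulr_sumr -big_split/=; apply: ler_sum => i _.
by rewrite mulr_sumr -!big_split/=; apply: ler_sum => j _.
Qed.

End barrier.


(** * Borel measurability *)

Section borel.

Lemma open_borel {T : ptopologicalType} (U : set T) :
  open U -> measurable (U : set (borel T)).
Proof. by move=> oU; exact: sub_sigma_algebra. Qed.

Lemma measurable_to_borel {d} {S : measurableType d} {T : ptopologicalType}
    (f : S -> T) : (forall U, open U -> measurable (f @^-1` U)) ->
  measurable_fun setT (f : S -> borel T).
Proof.
move=> mf; apply: (@measurability _ _ S (borel T) setT f open) => //.
by move=> _ [U oU <-]; rewrite setTI; exact: mf.
Qed.

Lemma measurable_to_real {R : realType} {d} {S : measurableType d}
    (f : S -> R) : (forall U : set R, open U -> measurable (f @^-1` U)) ->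
  measurable_fun setT f.
Proof.
move=> mf mS; apply: (measurability _ (RGenOpens.measurableE R)) => //.
move=> _ [_ [a [b ->] <-]]; rewrite setTI; apply: mf; exact: interval_open.
Qed.

Lemma continuous_borel {S T : ptopologicalType} (f : S -> T) : continuous f ->
  measurable_fun setT (f : borel S -> borel T).
Proof.
by move=> /continuousP cf; apply: measurable_to_borel => U /cf; exact: open_borel.
Qed.

Lemma continuous_borel_real {R : realType} {S : ptopologicalType} (f : S -> R) :
  continuous f -> measurable_fun setT (f : borel S -> R).
Proof.
by move=> /continuousP cf; apply: measurable_to_real => U /cf; exact: open_borel.
Qed.

End borel.

Section metric.
Context {R : realType} {X : ptopologicalType} {d : X -> X -> \bar R}.
Hypothesis hd : ext_metric_topological d.
Hypothesis dX : separable_metric d.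
Hypothesis dtau : induced_by d.
Implicit Types x y : X.

Lemma dist_fin x y : (d x y = (fine (d x y))%:E)%E.
Proof.
rewrite fineK// fin_numE; have := dX.1 x y; have := emt_ge0 hd x y.
by case: (d x y).
Qed.

Lemma dball_open x r : open (dball d x r).
Proof.
apply/dtau => y; rewrite /dball/= dist_fin lte_fin => yr.
exists (r - fine (d x y)); first by rewrite subr_gt0.
move=> z; rewrite /dball/= => yz; apply: le_lt_trans (emt_triangle hd x y z) _.
by rewrite dist_fin -lteBrDl// -EFinB.
Qed.

Lemma dball_nbhs x r : 0 < r -> nbhs x (dball d x r).
Proof.
move=> r0; apply: open_nbhs_nbhs; split; first exact: dball_open.
by rewrite /dball/= (emt_eq0 hd x x).2.
Qed.

Lemma nbhs_dball x U : nbhs x U -> exists2 e : R, 0 < e & dball d x e `<=` U.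
Proof.
rewrite nbhsE => -[V [oV Vx] VU]; have [e e0 eV] := (dtau V).1 oV x Vx.
by exists e => //; exact: subset_trans VU.
Qed.

Lemma dlipschitz_continuous (f : X -> R) : dlipschitz d f -> continuous f.
Proof.
move=> [L L0 Lf] x; apply/cvgrPdist_lt => e e0.
have h : 0 < e / (L + 1) by rewrite divr_gt0// ltr_wpDl.
near=> y.
have : dball d x (e / (L + 1)) y by near: y; exact: dball_nbhs.
rewrite /dball/= dist_fin lte_fin ltr_pdivlMr ?ltr_wpDl// => xy.
have := Lf x y; rewrite dist_fin -EFinM lee_fin => /le_lt_trans; apply.
apply: le_lt_trans xy; rewrite mulrC ler_wpM2l ?lerDl//.
by rewrite fine_ge0// (emt_ge0 hd).
Unshelve. all: by end_near. Qed.

Lemma dtrunc_continuous (a : R) : 0 <= a ->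
  continuous (fun z : X * X => dtrunc d a z.1 z.2).
Proof.
move=> a0 [x y]; apply/cvgrPdist_lt => e e0 /=.
have e2 : 0 < e / 2 by rewrite divr_gt0.
exists (dball d x (e / 2), dball d y (e / 2)) => /=.
  by split; exact: dball_nbhs.
move=> [x' y'] [/= xx' yy'].
have h1 := dtrunc_dist hd a0 x x' y.
have h2 := dtrunc_dist hd a0 y y' x'.
have hx : dtrunc d a x x' < e / 2.
  by rewrite -lte_fin; exact: le_lt_trans (dtrunc_le_dist hd x x') xx'.
have hy : dtrunc d a y y' < e / 2.
  by rewrite -lte_fin; exact: le_lt_trans (dtrunc_le_dist hd y y') yy'.
rewrite (dtrunc_sym hd y) (dtrunc_sym hd y') in h2.
by move: h1 h2; rewrite !ler_norml !ltr_norml; lra.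
Qed.

(** An enumeration of the countable dense set; [xget] provides the value at
    the integers that are not codes. *)
Lemma dense_sequence : exists g : nat -> X,
  forall x e, 0 < e -> exists n, dball d (g n) e x.
Proof.
have [D cD dD] := dX.2.
have [f finj] := countable_injP _ cD.
pose g n := xget point [set x | D x /\ f x = n].
exists g => x e e0.
have [y [Dy xy]] := dD (dball d x e) (ex_intro _ x (nbhs_singleton (dball_nbhs x e0)))
  (dball_open _ _).
exists (f y).
have -> : g (f y) = y.
  rewrite /g; apply: xget_unique; first by split.
  move=> z [Dz fz]; apply: finj => //; exact/mem_set.
by rewrite /dball/= (emt_sym hd).
Qed.

(** Here separability enters: an open subset of the square is the union of
    the countably many rectangles of balls with centres in the dense sequence
    that it contains. Without it the Borel sets of [X * X] may be more numerous
    than those generated by rectangles. *)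
Lemma open_measurable_prod (O : set (X * X)) : open O ->
  measurable (O : set (borel X * borel X)%type).
Proof.
move=> oO; have [g gd] := dense_sequence.
pose r (n : nat) : R := n.+1%:R^-1.
pose B i j n := dball d (g i) (r n) `*` dball d (g j) (r n).
have -> : O = \bigcup_i \bigcup_j \bigcup_(n in [set n | B i j n `<=` O]) B i j n.
  apply/seteqP; split => [[x y] Oxy|z [i _ [j _ [n BO Bz]]]]; last exact: BO.
  have [[U V] /= [nU nV] UV] : nbhs (x, y) O by apply: open_nbhs_nbhs.
  have [e1 e10 h1] := nbhs_dball nU; have [e2 e20 h2] := nbhs_dball nV.
  have [n ne] : exists n, 2 * r n < Num.min e1 e2.
    have m0 : 0 < Num.min e1 e2 / 2 by rewrite divr_gt0// lt_min e10.
    have [n _ h] := near_infty_natSinv_lt (PosNum m0).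
    exists n; have := h n (leqnn n); rewrite /= /r => ?.
    by rewrite mulrC -ltr_pdivlMr.
  have r0 : 0 < r n by rewrite /r.
  have [i xi] := gd x _ r0; have [j yj] := gd y _ r0.
  have half a b c e : dball d a (r n) b -> dball d a (r n) c ->
      Num.min e1 e2 <= e -> dball d b e c.
    rewrite /dball/= => ab ac le_e.
    apply: le_lt_trans (emt_triangle hd b a c) _; rewrite (emt_sym hd b).
    apply: (@lt_le_trans _ _ (r n + r n)%:E).
      by rewrite EFinD; exact: lteD.
    by rewrite lee_fin; lra.
  exists i => //; exists j => //; exists n; last by split.
  move=> [x' y'] [/= xx' yy']; apply: UV; split => /=.
    by apply/h1/(half (g i)) => //; rewrite ge_min lexx.
  by apply/h2/(half (g j)) => //; rewrite ge_min lexx orbT.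
apply: bigcupT_measurable => i; apply: bigcupT_measurable => j.
apply: bigcup_measurable => n _; apply: measurableX; apply: open_borel; exact: dball_open.
Qed.

Lemma continuous_prod_borel {T : ptopologicalType} (f : X * X -> T) : continuous f ->
  measurable_fun setT (f : (borel X * borel X)%type -> borel T).
Proof.
by move=> /continuousP cf; apply: measurable_to_borel => U /cf; exact: open_measurable_prod.
Qed.

Lemma continuous_prod_real (f : X * X -> R) : continuous f ->
  measurable_fun setT (f : (borel X * borel X)%type -> R).
Proof.
by move=> /continuousP cf; apply: measurable_to_real => U /cf; exact: open_measurable_prod.
Qed.

(** * The metric cone *)

Local Notation C := (cone d).
Implicit Types p q : C.

Lemma cone_rad_ge0 p : 0 <= cone_rad p.
Proof. by rewrite /cone_rad. Qed.

Definition cone_sqdist p q : R := cone_rad p ^+ 2 + cone_rad q ^+ 2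
    - 2 * cone_rad p * cone_rad q * cos (dtrunc d pi (cone_base p) (cone_base q)).

Lemma cone_sqdist_ge p q (c : R) :
  cos (dtrunc d pi (cone_base p) (cone_base q)) <= c ->
  cone_rad p ^+ 2 + cone_rad q ^+ 2 - 2 * cone_rad p * cone_rad q * c <=
  cone_sqdist p q.
Proof.
by move=> h; rewrite lerB// ler_wpM2l// !mulr_ge0// cone_rad_ge0.
Qed.

Lemma cone_sqdist_ge_sq p q : (cone_rad p - cone_rad q) ^+ 2 <= cone_sqdist p q.
Proof. by apply: le_trans (cone_sqdist_ge (cos_le1 _)); rewrite mulr1; lra. Qed.

Lemma cone_dist_sq p q : cone_dist p q ^+ 2 = cone_sqdist p q.
Proof.
by rewrite /cone_dist sqr_sqrtr// (le_trans _ (cone_sqdist_ge_sq p q))// sqr_ge0.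
Qed.

Lemma cone_rad_lipschitz p q : `|cone_rad p - cone_rad q| <= cone_dist p q.
Proof.
rewrite -sqrtr_sqr; apply: ler_wsqrtr; exact: cone_sqdist_ge_sq.
Qed.

Lemma cone_rad_continuous : continuous (@cone_rad R X d).
Proof.
apply/continuousP => U oU; rewrite cone_openE => p Up.
have /nbhs_ballP[e /= e0 eU] : nbhs (cone_rad p) U by apply: open_nbhs_nbhs.
exists e => // q /= pq; apply: eU; rewrite /ball/=.
exact: le_lt_trans (cone_rad_lipschitz p q) pq.
Qed.

(** In the plane, the distance from a point at radius [r] to a ray making an
    angle [t] with it is [r * sin t]: a smaller cone distance forces a smaller
    angle, and also keeps away from the vertex. *)
Lemma cone_base_near p e : 0 < cone_rad p -> 0 < e ->
  exists2 r, 0 < r & forall q, cone_dist p q < r ->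
    0 < cone_rad q /\ dball d (cone_base p) e (cone_base q).
Proof.
move=> p0 e0; have pi0 := @pi_gt0 R.
pose t := Num.min e (pi / 2).
have t0 : 0 < t by rewrite lt_min e0 divr_gt0.
have tpi : t <= pi / 2 by rewrite ge_min lexx orbT.
have sint : 0 < sin t by apply: sin_gt0_pi; rewrite t0/=; lra.
exists (cone_rad p * sin t); first exact: mulr_gt0.
move=> q pq; have q0 : 0 < cone_rad q.
  have h1 : cone_dist p q < cone_rad p.
    by apply: lt_le_trans pq _; rewrite ler_piMr// ?ltW// sin_le1.
  by have := le_lt_trans (cone_rad_lipschitz p q) h1; rewrite ltr_norml; lra.
split => //; rewrite /dball/= ltNge; apply/negP => le_e.
suff : (cone_rad p * sin t) ^+ 2 <= cone_dist p q ^+ 2.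
  rewrite (ler_pXn2r (ltn0Sn 1)) ?nnegrE ?sqrtr_ge0 ?mulr_ge0 ?(ltW p0) ?(ltW sint)//.
  by move=> /le_lt_trans/(_ pq); rewrite ltxx.
rewrite cone_dist_sq; apply: le_trans (cone_sqdist_ge (c := cos t) _).
  rewrite exprMn sin2cos2.
  have := sqr_ge0 (cone_rad q - cone_rad p * cos t); lra.
apply: cos_antitone; first exact: ltW.
  rewrite -lee_fin (dtruncE hd) le_min (le_trans _ le_e)/= ?lee_fin ?ge_min ?lexx//.
  lra.
exact: dtrunc_le.
Qed.

Lemma cone_base_open (U : set X) : open U ->
  open [set p : C | 0 < cone_rad p /\ U (cone_base p)].
Proof.
move=> /dtau oU; rewrite cone_openE => p [p0 /oU[e e0 eU]]; have [r r0 h] := cone_base_near p0 e0.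
by exists r => // q /h[q0 /eU].
Qed.

(** The base point is discontinuous only at the vertex, and the vertex is a
    closed set on which it is constant. *)
Lemma cone_base_measurable :
  measurable_fun setT (@cone_base R X d : borel C -> borel X).
Proof.
apply: measurable_to_borel => U oU.
have -> : @cone_base R X d @^-1` U = [set p : C | 0 < cone_rad p /\ U (cone_base p)] `|`
   (~` [set p : C | 0 < cone_rad p] `&` [set p : C | U point]).
  apply/seteqP; split => [p /= Up|p /=].
    have [p0|p0] := ltP 0 (cone_rad p); [by left|right; split; first exact/negP].
    by move: Up; rewrite /cone_base ltNge p0.
  by move=> [[]//|[/negP p0]]; rewrite /cone_base (negbTE p0).
apply: measurableU; first by apply: (@open_borel C); exact: cone_base_open.
have -> : [set p : C | U point] = if `[<U point>] then setT else set0.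
  by case: asboolP => h; apply/seteqP; split.
apply: measurableI; last by case: ifP.
apply: measurableC; apply: open_borel.
rewrite [X in open X](_ : _ = @cone_rad R X d @^-1` [set x | 0 < x])//.
exact: ((continuousP (@cone_rad R X d)).1 cone_rad_continuous _ (@open_gt R 0)).
Qed.

Lemma cone_pt_continuous r : continuous (fun x => cone_pt d x r).
Proof.
apply/continuousP => U oU; apply/dtau => x Ux.
have [e e0 eU] := oU _ Ux.
have K0 : 0 < 1 + 2 * r%:num ^+ 2 by rewrite ltr_wpDr// mulr_ge0// sqr_ge0.
exists (e ^+ 2 / (1 + 2 * r%:num ^+ 2)).
  by rewrite divr_gt0// exprn_gt0.
move=> y; rewrite /dball/= => xy; apply: eU => /=.
have : dtrunc d pi x y < e ^+ 2 / (1 + 2 * r%:num ^+ 2).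
  by rewrite -lte_fin; apply: le_lt_trans xy; exact: (dtrunc_le_dist hd x y).
rewrite ltr_pdivlMr// => h.
have D0 := dtrunc_ge0 hd (@pi_ge0 R) x y.
have : 1 - cos (dtrunc d pi x y) <= dtrunc d pi x y.
  have := cos_lipschitz 0 (dtrunc d pi x y).
  rewrite cos0 sub0r normrN (ger0_norm D0); apply: le_trans; exact: ler_norm.
move=> hc; rewrite cone_dist_pt.
rewrite -[ltRHS](ger0_norm (ltW e0)) -sqrtr_sqr ltr_sqrt ?exprn_gt0//.
apply: le_lt_trans h; have := ler_wpM2l (sqr_ge0 r%:num) hc; lra.
Qed.

Let CC : ptopologicalType := (C * C)%type.

Lemma cone_pair_continuous r s :
  continuous ((fun z : X * X => (cone_pt d z.1 r, cone_pt d z.2 s)) : X * X -> CC).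
Proof.
move=> z W [[U V] /= [nU nV] UV].
exists ((fun x => cone_pt d x r) @^-1` U, (fun x => cone_pt d x s) @^-1` V) => /=.
  by split; [exact: (cone_pt_continuous nU)|exact: (cone_pt_continuous nV)].
by move=> [x y] [/= Ux Vy]; exact: (UV (_, _)).
Qed.

Lemma borel_fst : measurable_fun setT (fst : borel CC -> borel C).
Proof. by apply: (@continuous_borel CC C) => z; exact: cvg_fst. Qed.

Lemma borel_snd : measurable_fun setT (snd : borel CC -> borel C).
Proof. by apply: (@continuous_borel CC C) => z; exact: cvg_snd. Qed.

Lemma borel_rad : measurable_fun setT (@cone_rad R X d : borel C -> R).
Proof. exact: (continuous_borel_real cone_rad_continuous). Qed.

Lemma borel_rad1 : measurable_fun setT ((fun z => cone_rad z.1) : borel CC -> R).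
Proof. exact: measurableT_comp borel_rad borel_fst. Qed.

Lemma borel_rad2 : measurable_fun setT ((fun z => cone_rad z.2) : borel CC -> R).
Proof. exact: measurableT_comp borel_rad borel_snd. Qed.

Lemma borel_base1 : measurable_fun setT ((fun z => cone_base z.1) : borel CC -> borel X).
Proof. exact: measurableT_comp cone_base_measurable borel_fst. Qed.

Lemma borel_base2 : measurable_fun setT ((fun z => cone_base z.2) : borel CC -> borel X).
Proof. exact: measurableT_comp cone_base_measurable borel_snd. Qed.

Lemma borel_cone_dist : measurable_fun setT
  ((fun z => cone_dist z.1 z.2 ^+ 2) : borel CC -> R).
Proof.
have -> : (fun z : CC => cone_dist z.1 z.2 ^+ 2) = (fun z => cone_sqdist z.1 z.2).
  by apply/funext => z; rewrite cone_dist_sq.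
apply: measurable_funB.
  by apply: measurable_funD; apply: measurable_funX; [exact: borel_rad1|exact: borel_rad2].
apply: measurable_funM.
  apply: measurable_funM; last exact: borel_rad2.
  by apply: measurable_funM; [exact: measurable_cst|exact: borel_rad1].
have mc : measurable_fun setT
    ((fun z => cos (dtrunc d pi z.1 z.2)) : (borel X * borel X)%type -> R).
  apply: continuous_prod_real => z.
  apply: (@continuous_comp _ _ _ (fun z : X * X => dtrunc d pi z.1 z.2) cos).
    by apply: dtrunc_continuous; exact: pi_ge0.
  exact: continuous_cos.
exact: (measurableT_comp mc (measurable_fun_pair borel_base1 borel_base2)).
Qed.

End metric.


(** * Weak duality *)

Section change_of_variables.
Context {R : realType} {d1 d2 : measure_display}
  {T : measurableType d1} {Y : measurableType d2}
  {alpha : {measure set T -> \bar R}} {mu : {measure set Y -> \bar R}}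
  {phi : T -> Y} {w : T -> R}.
Hypothesis mphi : measurable_fun setT phi.
Hypothesis mw : measurable_fun setT w.
Hypothesis w0 : forall z, 0 <= w z.
Hypothesis muE : forall A, measurable A ->
  (\int[alpha]_(z in phi @^-1` A) (w z)%:E = mu A)%E.

Import HBNNSimple.

(** For indicator functions this is the hypothesis on [mu]. *)
Lemma weighted_integral_nnsfun (h : {nnsfun Y >-> R}) :
  (\int[alpha]_z (h (phi z) * w z)%:E = \int[mu]_y (h y)%:E)%E.
Proof.
pose A r := h @^-1` [set r].
have mA r : measurable (A r).
  by rewrite /A -[X in measurable X]setTI; exact: measurable_funP.
rewrite integralT_nnsfun sintegralE.
transitivity (\int[alpha]_z
    (\sum_(r \in range h) (`|r| * (\1_(A r) (phi z) * w z))%:E))%E.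
  apply: eq_integral => z _; rewrite fimfunE fsumEFin//; congr EFin.
  rewrite !fsbig_finite// mulr_suml; apply: eq_big_seq => r.
  by rewrite in_fset_set// inE => -[y _ <-]; rewrite ger0_norm// mulrA.
rewrite ge0_integral_fsum//.
- apply: eq_fsbigr => r /[!inE] -[y _ hy].
  under eq_integral do rewrite EFinM.
  rewrite ge0_integralZl_EFin//; last 2 first.
  + by move=> z _; rewrite lee_fin mulr_ge0.
  + apply/measurable_EFinP; apply: measurable_funM => //.
    by apply: measurableT_comp => //; exact: measurable_indic.
  have -> : `|r| = r by rewrite ger0_norm// -hy.
  congr (_ * _)%E; rewrite -muE// [RHS]integral_mkcond.
  apply: eq_integral => z _; rewrite patchE indicE.
  have -> : (z \in phi @^-1` A r) = (phi z \in A r).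
    by apply/idP/idP; rewrite !inE.
  by case: ifP => _; rewrite ?mul1r ?mul0r.
- move=> r; apply/measurable_EFinP; apply: measurable_funM => //.
  apply: measurable_funM => //.
  by apply: measurableT_comp => //; exact: measurable_indic.
- by move=> r z _; rewrite lee_fin !mulr_ge0.
Qed.

(** A homogeneous marginal is the image of a density times the plan, so that
    integrals against it are integrals of the pulled back function against the
    plan. The case of simple functions passes to the limit monotonically. *)
Lemma weighted_integral (g : Y -> R) : measurable_fun setT g ->
  (forall y, 0 <= g y) ->
  (\int[alpha]_z (g (phi z) * w z)%:E = \int[mu]_y (g y)%:E)%E.
Proof.
move=> mg g0.
have mEg : measurable_fun setT (EFin \o g) by apply/measurable_EFinP.
have Eg0 y : [set: Y] y -> (0 <= (EFin \o g) y)%E by rewrite lee_fin.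
pose g_ := nnsfun_approx measurableT mEg.
have ndg y : {homo (fun n => g_ n y) : a b / (a <= b)%N >-> (a <= b)%R}.
  by move=> a b ab; exact/lefP/nd_nnsfun_approx.
have cvgg y : (g_ n y)%:E @[n --> \oo] --> (g y)%:E.
  exact: (cvg_nnsfun_approx measurableT mEg Eg0).
transitivity (limn (fun n => \int[alpha]_z (g_ n (phi z) * w z)%:E))%E.
  rewrite -monotone_convergence//.
  - apply: eq_integral => z _; apply/esym/cvg_lim => //.
    have h := @cvgeZr _ _ _ _ _ _ (isT : (w z)%:E \is a fin_num) (cvgg (phi z)); exact: h.
  - move=> n; apply/measurable_EFinP; apply: measurable_funM => //.
    by apply: measurableT_comp.
  - by move=> n z _; rewrite lee_fin mulr_ge0.
  - by move=> z _ a b ab; rewrite lee_fin ler_wpM2r// ndg.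
under eq_fun do rewrite weighted_integral_nnsfun.
rewrite -monotone_convergence//.
- by apply: eq_integral => y _; apply/cvg_lim.
- by move=> n; apply/measurable_EFinP.
- by move=> n z _; rewrite lee_fin.
- by move=> z _ a b ab; rewrite lee_fin ndg.
Qed.

Lemma weighted_measurable (g : Y -> R) : measurable_fun setT g ->
  measurable_fun setT (fun z => g (phi z) * w z).
Proof.
by move=> mg; apply: measurable_funM => //; exact: measurableT_comp.
Qed.

End change_of_variables.

(** Splitting a pointwise inequality into nonnegative pieces on both sides
    makes it possible to integrate it term by term although the integrals may be
    infinite. *)
Lemma integral_sum_le {R : realType} {d} {T : measurableType d}
    {alpha : {measure set T -> \bar R}} {a1 a2 b1 b2 D : T -> R} {c : R} :
  0 <= c ->
  measurable_fun setT a1 -> measurable_fun setT a2 ->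
  measurable_fun setT b1 -> measurable_fun setT b2 -> measurable_fun setT D ->
  (forall z, 0 <= a1 z) -> (forall z, 0 <= a2 z) ->
  (forall z, 0 <= b1 z) -> (forall z, 0 <= b2 z) -> (forall z, 0 <= D z) ->
  (forall z, a1 z + a2 z <= c * D z + (b1 z + b2 z)) ->
  (\int[alpha]_z (a1 z)%:E + \int[alpha]_z (a2 z)%:E <=
   c%:E * \int[alpha]_z (D z)%:E +
   (\int[alpha]_z (b1 z)%:E + \int[alpha]_z (b2 z)%:E))%E.
Proof.
move=> c0 ma1 ma2 mb1 mb2 mD a10 a20 b10 b20 D0 h.
have mE (f : T -> R) : measurable_fun setT f -> measurable_fun setT (EFin \o f).
  by move=> ?; exact/measurable_EFinP.
have mcD : measurable_fun setT (fun z => (c%:E * (D z)%:E)%E).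
  by apply: (mE (fun z => c * D z)); apply: measurable_funM => //; exact: measurable_cst.
have mbb : measurable_fun setT (fun z => ((b1 z)%:E + (b2 z)%:E)%E).
  by apply: (mE (fun z => b1 z + b2 z)); exact: measurable_funD.
rewrite -ge0_integralZl_EFin//; [|by move=> z _; rewrite lee_fin|exact: mE].
rewrite -!ge0_integralD//; try by [exact: mE|move=> z _; rewrite -?EFinM lee_fin ?mulr_ge0].
  apply: ge0_le_integral => //.
  - by move=> z _; rewrite lee_fin addr_ge0.
  - by apply: (mE (fun z => a1 z + a2 z)); exact: measurable_funD.
  - by apply: (mE (fun z => c * D z + (b1 z + b2 z))); apply: measurable_funD;
      [apply: measurable_funM => //; exact: measurable_cst|exact: measurable_funD].
  - by move=> z _; rewrite lee_fin.
by move=> z _; rewrite lee_fin addr_ge0.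
Qed.

Section weak_duality.
Context {R : realType} {X : ptopologicalType} {d : X -> X -> \bar R}.
Hypothesis hd : ext_metric_topological d.
Hypothesis dX : separable_metric d.
Hypothesis dtau : induced_by d.

Local Notation C := (cone d).
Local Notation CC := (C * C)%type.

(** Weak duality before integration. Testing the infimum at the base point of
    [p], with [w = 1 + 2 xi] there and [c] the cosine of the angle, the
    difference of the two sides is half the square [(c s - w r) ^ 2 / w].
    Truncating the distance at [pi / 2] rather than at [pi] only replaces negative
    cosines by [0], which lowers the bound. *)
Lemma P1_cone_bound (xi : X -> R) (k : R) (p q : C) : 0 < k ->
  (forall x, k <= 1 + 2 * xi x) ->
  P1_real (d := d) xi (cone_base q) * cone_rad q ^+ 2 - xi (cone_base p) * cone_rad p ^+ 2
  <= 1 / 2 * cone_sqdist p q.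
Proof.
move=> k0 kxi.
set x := cone_base p; set y := cone_base q.
set r := cone_rad p; set s := cone_rad q.
have r0 : 0 <= r := cone_rad_ge0 p.
have s0 : 0 <= s := cone_rad_ge0 q.
pose w := 1 + 2 * xi x; have w0 : 0 < w := lt_le_trans k0 (kxi x).
pose c := cos (dtrunc d (pi / 2) y x).
have cE : cos (dtrunc d pi x y) <= c.
  have pi0 := @pi_ge0 R.
  rewrite /c (dtrunc_sym hd y); apply: cos_antitone.
  - by apply: dtrunc_ge0 => //; rewrite divr_ge0.
  - rewrite -lee_fin !dtruncE// le_min ge_min lexx /= ge_min; apply/orP; right.
    by rewrite lee_fin ler_pdivrMr// ler_peMr// ler1n.
  - exact: dtrunc_le.
apply: (@le_trans _ _ (1 / 2 * (r ^+ 2 + s ^+ 2 - 2 * r * s * c))); last first.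
  by rewrite ler_wpM2l//; exact: cone_sqdist_ge.
have h1 : P1_real (d := d) xi y * s ^+ 2 <= 1 / 2 * (1 - c ^+ 2 / w) * s ^+ 2.
  by rewrite ler_wpM2r ?sqr_ge0//; exact: (P1_real_lbound hd k0 kxi y x).
have h2 : 0 <= (c * s - w * r) ^+ 2 / w by rewrite divr_ge0 ?sqr_ge0// ltW.
have h3 : (c * s - w * r) ^+ 2 / w = c ^+ 2 / w * s ^+ 2 - 2 * r * s * c + w * r ^+ 2.
  by field; rewrite gt_eqF.
have h4 : xi x = (w - 1) / 2 by rewrite /w; field.
rewrite h4; rewrite h3 in h2; lra.
Qed.

Lemma Lip_b_borel (f : X -> R) : Lip_b d f -> measurable_fun setT (f : borel X -> R).
Proof.
by move=> [_ Lf]; apply: continuous_borel_real; exact: dlipschitz_continuous Lf.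
Qed.

Lemma weak_duality (mu0 mu1 : {finite_measure set (borel X) -> \bar R})
    (xi : X -> R) : Lip_b d xi ->
  ((- (1 / 2))%:E < ereal_inf (range (EFin \o xi)))%E ->
  (\int[mu1]_x P1 d xi x - \int[mu0]_x (xi x)%:E <= (1 / 2)%:E * HK2 d mu0 mu1)%E.
Proof.
move=> Lxi /inf_gt_lbound[k k0 kxi].
rewrite muleC -lee_pdivrMr//.
apply: le_ereal_inf_tmp => _ [alpha [ralpha finalpha m0 m1] <-].
rewrite lee_pdivrMr// muleC.
have mxi := Lip_b_borel Lxi.
have mQ := Lip_b_borel (P1_real_Lip_b hd k0 kxi).
have [[M [Mr bM]] _] := Lxi.
have [K [K0 Kxi KQ]] : exists K : R, [/\ 0 < K, forall x, `|xi x| <= K &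
    forall x, `|P1_real (d := d) xi x| <= K].
  pose N := Num.max (M + 1) (1 / 2 + 1 / 2 * k^-1).
  have k1 : 0 < k^-1 by rewrite invr_gt0.
  exists N; split.
  - by rewrite lt_max; apply/orP; right; lra.
  - by move=> x; apply: bM => //; rewrite lt_max ltrDl ltr01.
  - by move=> x; apply: le_trans (P1_real_bound hd k0 kxi x) _; rewrite le_max lexx orbT.
(* The constant [K] makes both integrands nonnegative; its contributions to
   the two sides are the same total masses. *)
pose f1 x := K - P1_real (d := d) xi x; pose f0 x := K + xi x.
have f1_ge0 x : 0 <= f1 x by have := KQ x; rewrite ler_norml /f1; lra.
have f0_ge0 x : 0 <= f0 x by have := Kxi x; rewrite ler_norml /f0; lra.
have mf1 : measurable_fun setT (f1 : borel X -> R).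
  by apply: measurable_funB => //; exact: measurable_cst.
have mf0 : measurable_fun setT (f0 : borel X -> R).
  by apply: measurable_funD => //; exact: measurable_cst.
have mr1 : measurable_fun setT ((fun z : CC => cone_rad z.1 ^+ 2) : borel CC -> R).
  by apply: measurable_funX; exact: borel_rad1.
have mr2 : measurable_fun setT ((fun z : CC => cone_rad z.2 ^+ 2) : borel CC -> R).
  by apply: measurable_funX; exact: borel_rad2.
have W0 := weighted_integral (borel_base1 hd dtau) mr1 (fun z => sqr_ge0 _) m0.
have W1 := weighted_integral (borel_base2 hd dtau) mr2 (fun z => sqr_ge0 _) m1.
have cK (m : {finite_measure set (borel X) -> \bar R}) :
    (\int[m]_x (K)%:E = K%:E * m setT)%E.
  by rewrite integral_cst.
have fin (m : {finite_measure set (borel X) -> \bar R}) : m setT \is a fin_num.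
  exact: fin_num_measure.
have bfin (m : {finite_measure set (borel X) -> \bar R}) (f : X -> R) :
    measurable_fun setT (f : borel X -> R) -> (forall x, `|f x| <= K + K) ->
    m.-integrable setT (EFin \o f).
  move=> mf bf; apply: (@le_integrable _ _ _ m _ measurableT _ (EFin \o cst (K + K))).
  - exact/measurable_EFinP.
  - by move=> x _ /=; rewrite lee_fin (ger0_norm (addr_ge0 (ltW K0) (ltW K0))).
  - exact: finite_measure_integrable_cst.
have KK x : x <= K -> x <= K + K by move=> /le_trans; apply; rewrite lerDl ltW.
have iQ := bfin mu1 _ mQ (fun x => KK _ (KQ x)).
have ixi := bfin mu0 _ mxi (fun x => KK _ (Kxi x)).
have icst (m : {finite_measure set (borel X) -> \bar R}) : m.-integrable setT (EFin \o cst K).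
  exact: finite_measure_integrable_cst.
have PE : (\int[mu1]_x P1 d xi x = \int[mu1]_x (P1_real (d := d) xi x)%:E)%E.
  by apply: eq_integral => x _; rewrite (P1_realE hd k0 kxi).
have I1 : (\int[mu1]_x (f1 x)%:E =
    K%:E * mu1 setT - \int[mu1]_x (P1_real (d := d) xi x)%:E)%E.
  by rewrite -cK; exact: (integralB_EFin measurableT (icst mu1) iQ).
have I0 : (\int[mu0]_x (f0 x)%:E = K%:E * mu0 setT + \int[mu0]_x (xi x)%:E)%E.
  by rewrite -cK; exact: (integralD_EFin measurableT (icst mu0) ixi).
have mD := borel_cone_dist hd dX dtau.
have D0 (z : CC) : 0 <= cone_dist z.1 z.2 ^+ 2 by exact: sqr_ge0.
have main : (K%:E * mu0 setT + K%:E * mu1 setT <=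
    (1 / 2)%:E * \int[alpha]_z (cone_dist z.1 z.2 ^+ 2)%:E +
    (\int[mu1]_x (f1 x)%:E + \int[mu0]_x (f0 x)%:E))%E.
  have cst_ge0 (y : borel X) : 0 <= cst K y by exact: ltW.
  rewrite -!cK.
  rewrite -(W0 (cst K) (measurable_cst _) cst_ge0) -(W1 (cst K) (measurable_cst _) cst_ge0).
  rewrite -(W0 f0 mf0 f0_ge0) -(W1 f1 mf1 f1_ge0).
  have c0 : 0 <= 1 / 2 :> R by rewrite divr_ge0.
  refine (integral_sum_le c0
    (weighted_measurable (borel_base1 hd dtau) mr1 (measurable_cst _))
    (weighted_measurable (borel_base2 hd dtau) mr2 (measurable_cst _))
    (weighted_measurable (borel_base2 hd dtau) mr2 mf1)
    (weighted_measurable (borel_base1 hd dtau) mr1 mf0)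
    mD _ _ _ _ D0 _).
  - by move=> z; rewrite mulr_ge0 ?sqr_ge0// ltW.
  - by move=> z; rewrite mulr_ge0 ?sqr_ge0// ltW.
  - by move=> z; rewrite mulr_ge0 ?sqr_ge0.
  - by move=> z; rewrite mulr_ge0 ?sqr_ge0.
  - move=> z; have := P1_cone_bound z.1 z.2 k0 kxi.
    by rewrite cone_dist_sq /f0 /f1 /cst; lra.
have finQ := integrable_fin_num measurableT iQ.
have finxi := integrable_fin_num measurableT ixi.
move: main finQ finxi; rewrite I1 I0 PE.
case: (mu0 setT) (fin mu0) => [m0r| |]// _; case: (mu1 setT) (fin mu1) => [m1r| |]// _.
case: (\int[mu1]_x _)%E => [q| |]//; case: (\int[mu0]_x _)%E => [x| |]//.
case: (\int[alpha]_z _)%E => [D| |] main _ _.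
- by move: main; rewrite !lee_fin; lra.
- by rewrite gt0_muley ?leey// lte_fin.
- by move: main; rewrite gt0_muleNy ?lte_fin.
Qed.

End weak_duality.


(** * Inner regularity *)

Lemma measureU_le {R : realType} {d} {T : measurableType d}
    (m : {measure set T -> \bar R}) (A B : set T) :
  measurable A -> measurable B -> (m (A `|` B) <= m A + m B)%E.
Proof. by move=> mA mB; exact: measureU2. Qed.

Section inner_regularity.
Context {R : realType} {d} {T : measurableType d} {m : {measure set T -> \bar R}}
  {cpt : set_system T}.
Hypothesis mfin : (m setT < +oo)%E.
Hypothesis cptm : forall K, cpt K -> measurable K.
Hypothesis cpt0 : cpt set0.
Hypothesis cptU : forall K L, cpt K -> cpt L -> cpt (K `|` L).
Hypothesis cptI : forall K : nat -> set T, (forall n, cpt (K n)) -> cpt (\bigcap_n K n).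

(** The family [cpt] stands for the compact sets, which enter through their
    stability under finite unions and countable intersections. *)
Definition inner_approx (A : set T) : Prop := forall e : R, 0 < e ->
  exists K, [/\ cpt K, K `<=` A & (m (A `\` K) < e%:E)%E].

Let pow_gt0 (e : R) n : 0 < e -> 0 < e / (2 ^ n.+1)%:R.
Proof. by move=> e0; rewrite divr_gt0// ltr0n expn_gt0. Qed.

Lemma measureU_lt (A B : set T) (a b : R) : measurable A -> measurable B ->
  (m A < a%:E)%E -> (m B < b%:E)%E -> (m (A `|` B) < (a + b)%:E)%E.
Proof.
move=> mA mB Aa Bb; apply: (@le_lt_trans _ _ (m A + m B)%E); first exact: measureU_le.
by rewrite EFinD; exact: lteD.
Qed.

Lemma inner_approxU (A B : set T) : measurable A -> measurable B ->
  inner_approx A -> inner_approx B -> inner_approx (A `|` B).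
Proof.
move=> mA mB iA iB e e0; have e2 : 0 < e / 2 by rewrite divr_gt0.
have [K [cK KA mK]] := iA _ e2; have [L [cL LB mL]] := iB _ e2.
have mK' := cptm cK; have mL' := cptm cL.
exists (K `|` L); split; [exact: cptU|exact: setUSS|].
apply: (@le_lt_trans _ _ (m ((A `\` K) `|` (B `\` L)))).
  apply: le_measure; rewrite ?inE.
  - by apply: measurableD; exact: measurableU.
  - by apply: measurableU; exact: measurableD.
  - by move=> x [[Ax|Bx] /not_orP[nK nL]]; [left|right].
by rewrite [e]splitr; apply: measureU_lt => //; exact: measurableD.
Qed.

(** A countable union of compact sets is not compact, but by continuity from
    above a finite part of it exhausts the measure. *)
Lemma inner_approx_bigcup (A : nat -> set T) : (forall n, measurable (A n)) ->
  (forall n, inner_approx (A n)) -> inner_approx (\bigcup_n A n).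
Proof.
move=> mA iA e e0; have e2 : 0 < e / 2 by rewrite divr_gt0.
have /choice[K HK] : forall n, exists K, [/\ cpt K, K `<=` A n &
    (m (A n `\` K) < (e / 2 / 2 / (2 ^ n.+1)%:R)%:E)%E].
  by move=> n; apply: iA; apply: pow_gt0; rewrite divr_gt0.
have mK n : measurable (K n) by apply: cptm; have [] := HK n.
(* A finite union [V N] loses at most [e / 2] of the union [U] of all the
   [K n], and [U] loses at most [e / 4] of the union of the [A n]. *)
pose V N := \big[setU/set0]_(i < N) K i.
have cV N : cpt (V N).
  elim: N => [|N IH]; first by rewrite /V big_ord0.
  by rewrite /V big_ord_recr; apply: cptU => //; have [] := HK N.
pose U := \bigcup_n K n.
have mU : measurable U by exact: bigcupT_measurable.
have mAU : measurable (\bigcup_n A n) by exact: bigcupT_measurable.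
have VU N : V N `<=` U by rewrite /V -bigcup_mkord; apply: bigcup_sub => i _; exact: bigcup_sup.
have mV N := cptm (cV N).
have h1 : (m (\bigcup_n A n `\` U) < (e / 2)%:E)%E.
  apply: (@le_lt_trans _ _ (e / 2 / 2)%:E); last first.
    by rewrite lte_fin ltr_pdivrMr// ltr_pMr// ltr1n.
  apply: (@le_trans _ _ (\sum_(n <oo) m (A n `\` K n))%E).
    apply: measure_sigma_subadditive.
    - by move=> n; exact: measurableD.
    - exact: measurableD.
    - move=> x [[n _ Anx] nU]; exists n => //; split => // Knx.
      by apply: nU; exists n.
  apply: le_trans (epsilon_trick0 xpredT _); last by rewrite divr_ge0// ltW.
  by apply: lee_nneseries => // n _; have [_ _ /ltW] := HK n.
have h2 : (m \o (fun N => U `\` V N)) N @[N --> \oo] --> (0 : \bar R)%E.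
  have -> : (0 : \bar R)%E = m (\bigcap_N (U `\` V N)).
    rewrite (_ : \bigcap_N _ = set0) ?measure0// -subset0 => x h.
    have [[n _ Kx] _] := h 0%N I; have [_] := h n.+1 I.
    by apply; rewrite /V -bigcup_mkord; exists n => //=.
  apply: nonincreasing_cvg_mu.
  - by apply: le_lt_trans mfin; apply: le_measure; rewrite ?inE//; exact: measurableD.
  - by move=> n; exact: measurableD.
  - by apply: bigcapT_measurable => n; exact: measurableD.
  - move=> a b ab; apply/subsetPset; apply: setDS.
    rewrite /V -!bigcup_mkord; apply: bigcup_subset => i /= ib.
    exact: leq_trans ib ab.
have [N hN] : exists N, (m (U `\` V N) < (e / 2)%:E)%E.
  have [|N _ hN] := h2 [set x | (x < (e / 2)%:E)%E].
    by apply: open_nbhs_nbhs; split; [exact: open_ereal_lt_ereal|rewrite /= lte_fin].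
  by exists N; apply: hN => /=.
exists (V N); split => //.
  by apply: subset_trans (VU N) _; apply: subset_bigcup => n _; have [] := HK n.
apply: (@le_lt_trans _ _ (m ((\bigcup_n A n `\` U) `|` (U `\` V N)))).
  apply: le_measure; rewrite ?inE; [exact: measurableD| |].
    by apply: measurableU; exact: measurableD.
  by move=> x [Ax nV]; have [Ux|nU] := pselect (U x); [right|left].
by rewrite [e]splitr; apply: measureU_lt => //; exact: measurableD.
Qed.

Lemma inner_approx_bigcap (A : nat -> set T) : (forall n, measurable (A n)) ->
  (forall n, inner_approx (A n)) -> inner_approx (\bigcap_n A n).
Proof.
move=> mA iA e e0; have e2 : 0 < e / 2 by rewrite divr_gt0.
have /choice[K HK] : forall n, exists K, [/\ cpt K, K `<=` A n &
    (m (A n `\` K) < (e / 2 / (2 ^ n.+1)%:R)%:E)%E].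
  by move=> n; apply: iA; exact: pow_gt0.
have mK n : measurable (K n) by apply: cptm; have [] := HK n.
exists (\bigcap_n K n); split.
- by apply: cptI => n; have [] := HK n.
- by move=> x Kx n _; have [_ + _] := HK n; apply; exact: Kx.
apply: (@le_lt_trans _ _ (e / 2)%:E); last by rewrite lte_fin ltr_pdivrMr// ltr_pMr// ltr1n.
apply: (@le_trans _ _ (\sum_(n <oo) m (A n `\` K n))%E).
  apply: measure_sigma_subadditive.
  - by move=> n; exact: measurableD.
  - by apply: measurableD; exact: bigcapT_measurable.
  - move=> x [Ax nK]; apply: contrapT => h; apply: nK => n _.
    by apply: contrapT => nKn; apply: h; exists n => //; split => //; exact: Ax.
apply: le_trans (epsilon_trick0 xpredT (ltW e2)).
by apply: lee_nneseries => // n _; have [_ _ /ltW] := HK n.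
Qed.

(** Requiring the approximation of the complement as well makes the class
    stable under complements; countable unions then need both preceding
    lemmas. *)
Lemma inner_regular_sigma_algebra : inner_approx setT ->
  sigma_algebra setT
    [set A | [/\ measurable A, inner_approx A & inner_approx (~` A)]].
Proof.
move=> iT; split.
- split => //; last by rewrite setC0.
  by move=> e e0; exists set0; split; rewrite ?setDv ?measure0.
- by move=> A [mA iA iCA]; rewrite setTD; split=> //; [exact: measurableC|rewrite setCK].
- move=> A hA; split.
  + by apply: bigcupT_measurable => n; have [] := hA n.
  + by apply: inner_approx_bigcup => n; have [] := hA n.
  + rewrite setC_bigcup; apply: inner_approx_bigcap => n; have [] := hA n => //.
    by move=> ? _ _; exact: measurableC.
Qed.

End inner_regularity.

Section measures.
Context {R : realType}.

Lemma pushforward_measure_ex {d1 d2} {T1 : measurableType d1} {T2 : measurableType d2}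
    (m : {measure set T1 -> \bar R}) {f : T1 -> T2} : measurable_fun setT f ->
  exists n : {measure set T2 -> \bar R}, (forall A, n A = m (f @^-1` A)) /\
    forall (D : set T2) (g : T2 -> R), measurable D -> measurable_fun setT g ->
      (forall y, 0 <= g y) ->
      (\int[n]_(y in D) (g y)%:E = \int[m]_(x in f @^-1` D) (g (f x))%:E)%E.
Proof.
move=> mf.
exists (measure_function_pushforward__canonical__measure_function_Measure m mf).
split; first by move=> A.
move=> D g mD mg g0; rewrite ge0_integral_pushforward//.
- by apply/measurable_EFinP; exact: measurable_funTS.
- by move=> y _; rewrite lee_fin.
Qed.

Lemma finite_measure_ex {d} {T : measurableType d} (m : {measure set T -> \bar R}) :
  (m setT < +oo)%E -> exists n : {finite_measure set T -> \bar R}, forall A, n A = m A.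
Proof.
by move=> mfin; exists (mfrestr measurableT mfin) => A /=; rewrite /mfrestr /mrestr setIT.
Qed.

(** The condition of being Radon, for set functions that are not packaged as
    finite measures. *)
Definition inner_regular {T : ptopologicalType} (m : set (borel T) -> \bar R) : Prop :=
  forall A : set (borel T), measurable A -> forall e : R, 0 < e ->
  exists K : set T, [/\ compact K, K `<=` A & (m (A `\` K) < e%:E)%E].

Lemma compact_borel {T : ptopologicalType} (K : set T) : hausdorff_space T ->
  compact K -> measurable (K : set (borel T)).
Proof.
move=> hT /(compact_closed hT) cK; rewrite -[K]setCK; apply: measurableC.
by apply: open_borel; exact: closed_openC.
Qed.

Lemma hausdorff_pair {S T : topologicalType} : hausdorff_space S ->
  hausdorff_space T -> hausdorff_space (S * T)%type.
Proof.
move=> hS hT [p1 p2] [q1 q2] pq; congr pair.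
- apply: hS => A B nA nB.
  have [|//|[x y] [/= Ax Bx]] := pq (fst @^-1` A) (fst @^-1` B).
  + exact: (@cvg_fst _ _ (nbhs p1) (nbhs p2)).
  + exact: (@cvg_fst _ _ (nbhs q1) (nbhs q2)).
  + by exists x.
- apply: hT => A B nA nB.
  have [|//|[x y] [/= Ax Bx]] := pq (snd @^-1` A) (snd @^-1` B).
  + exact: (@cvg_snd _ _ (nbhs p1) (nbhs p2)).
  + exact: (@cvg_snd _ _ (nbhs q1) (nbhs q2)).
  + by exists y.
Qed.

Lemma inner_regular_add {T : ptopologicalType}
    (m n : {measure set (borel T) -> \bar R}) : hausdorff_space T ->
  inner_regular m -> inner_regular n -> inner_regular (measure_add m n).
Proof.
move=> hT im inn A mA e e0; have e2 : 0 < e / 2 by rewrite divr_gt0.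
have [K [cK KA mK]] := im A mA _ e2; have [L [cL LA mL]] := inn A mA _ e2.
exists (K `|` L); split; first exact: compactU.
  by rewrite subUset.
have mK' := compact_borel hT cK; have mL' := compact_borel hT cL.
rewrite measure_addE [e]splitr EFinD; apply: lteD.
  apply: le_lt_trans mK; apply: le_measure; rewrite ?inE.
  - by apply: measurableD => //; exact: measurableU.
  - exact: measurableD.
  - by apply: setDS; exact: subsetUl.
apply: le_lt_trans mL; apply: le_measure; rewrite ?inE.
- by apply: measurableD => //; exact: measurableU.
- exact: measurableD.
- by apply: setDS; exact: subsetUr.
Qed.

Lemma inner_regular_restr {T : ptopologicalType} (A : set (borel T))
    (mA : measurable A)
    (m : {measure set (borel T) -> \bar R}) : hausdorff_space T ->
  inner_regular m -> inner_regular (mrestr m mA).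
Proof.
move=> hT im B mB e e0; have [K [cK KB mK]] := im B mB e e0.
exists K; split => //; apply: le_lt_trans mK; rewrite /mrestr.
have mK' := compact_borel hT cK.
apply: le_measure; rewrite ?inE; [|exact: measurableD|exact: subIsetl].
by apply: measurableI => //; exact: measurableD.
Qed.

Lemma inner_regular_dirac {T : ptopologicalType} (x : T) : hausdorff_space T ->
  inner_regular (\d_ (x : borel T) : set (borel T) -> \bar R).
Proof.
move=> hT A mA e e0; have [Ax|nAx] := pselect (A x).
  exists [set x]; split; [exact: compact_set1|by move=> _ ->|].
  by rewrite diracE memNset ?lte_fin//; move=> [_ /(_ erefl)].
exists set0; split; [exact: compact0|exact: sub0set|].
by rewrite diracE memNset ?lte_fin// setD0.
Qed.

End measures.

Section product.
Context {R : realType} {X : ptopologicalType} {d : X -> X -> \bar R}.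
Hypothesis hd : ext_metric_topological d.
Hypothesis dX : separable_metric d.
Hypothesis dtau : induced_by d.

(** A rectangle is approximated by a product of compact sets, and the
    complement of a rectangle is a union of two rectangles. Hence the
    sigma-algebra of the approximable sets contains all the measurable sets. *)
Lemma product_inner_regular (rho sigma : {finite_measure set (borel X) -> \bar R}) :
  radon rho -> radon sigma ->
  forall A : set (borel X * borel X), measurable A -> forall e : R, 0 < e ->
  exists K : set (X * X), [/\ compact K, K `<=` A &
    ((rho \x sigma) (A `\` K) < e%:E)%E].
Proof.
move=> rrho rsigma.
have hX := emt_hausdorff hd.
have hXX : hausdorff_space (X * X)%type by exact: hausdorff_pair.
pose cpt : set_system (borel X * borel X)%type := @compact (X * X)%type.
pose nu : {measure set (borel X * borel X) -> \bar R} := (rho \x sigma)%E.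
have nuE (A B : set (borel X)) : measurable A -> measurable B ->
    nu (A `*` B) = (rho A * sigma B)%E.
  by move=> mA mB; exact: product_measure1E.
have cptm K : cpt K -> measurable K.
  move=> /(compact_closed hXX) cK; rewrite -[K]setCK; apply: measurableC.
  by apply: (open_measurable_prod hd dX dtau); exact: closed_openC.
have cpt0 : cpt set0 by exact: compact0.
have cptU K L : cpt K -> cpt L -> cpt (K `|` L) by exact: compactU.
have cptI (K : nat -> set (borel X * borel X)) :
    (forall n, cpt (K n)) -> cpt (\bigcap_n K n).
  move=> cK; apply: (@subclosed_compact (X * X)%type _ (K 0%N)); last 2 first.
  - exact: cK.
  - exact: bigcap_inf.
  by apply: closed_bigI => n _; apply: compact_closed => //; exact: cK.
have nuT : (nu setT < +oo)%E.
  rewrite -setXTT nuE// ltey_eq fin_numM//; exact: fin_num_measure.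
have iX (A B : set (borel X)) : measurable A -> measurable B ->
    inner_approx (m := nu) (cpt := cpt) (A `*` B).
  move=> mA mB e e0.
  pose M := fine (rho setT) + fine (sigma setT) + 1.
  have f0 : 0 <= fine (rho setT) by exact: fine_ge0.
  have f1 : 0 <= fine (sigma setT) by exact: fine_ge0.
  have M0 : 0 < M by rewrite /M; lra.
  have eM : 0 < e / M by rewrite divr_gt0.
  have [K [cK KA rK]] := rrho A mA _ eM; have [L [cL LB sL]] := rsigma B mB _ eM.
  have mK := compact_borel hX cK; have mL := compact_borel hX cL.
  exists (K `*` L); split; [exact: compact_setX|exact: setSX|].
  apply: (@le_lt_trans _ _ (nu (((A `\` K) `*` setT) `|` (setT `*` (B `\` L))))).
    apply: le_measure; rewrite ?inE.
    - by apply: measurableD; exact: measurableX.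
    - by apply: measurableU; apply: measurableX => //; exact: measurableD.
    - move=> [x y] [[/= Ax By] h]; have [Kx|nK] := pselect (K x); last by left.
      by right; split => //; split => // Ly; apply: h.
  have mP : measurable ((A `\` K) `*` [set: borel X]).
    by apply: measurableX => //; exact: measurableD.
  have mQ : measurable ([set: borel X] `*` (B `\` L)).
    by apply: measurableX => //; exact: measurableD.
  apply: (le_lt_trans (measureU_le nu mP mQ)).
  rewrite !nuE//; try exact: measurableD.
  have fr := fin_num_measure rho _ (@measurableT _ _).
  have fs := fin_num_measure sigma _ (@measurableT _ _).
  have frA := fin_num_measure rho _ (measurableD mA mK).
  have fsB := fin_num_measure sigma _ (measurableD mB mL).
  move: rK sL; rewrite -(fineK frA) -(fineK fsB) -(fineK fr) -(fineK fs) !lte_fin => rK sL.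
  have arith (a b p q : R) : 0 <= p -> 0 <= q -> a < e / (p + q + 1) ->
      b < e / (p + q + 1) -> a * q + p * b < e.
    move=> p0 q0 ha hb; have P0 : 0 < p + q + 1 by lra.
    have ee : e = e / (p + q + 1) * (p + q + 1) by rewrite divfK// gt_eqF.
    have u0 : 0 < e / (p + q + 1) by rewrite divr_gt0.
    have := ler_wpM2r q0 (ltW ha); have := ler_wpM2l p0 (ltW hb).
    move: (e / (p + q + 1)) u0 ee => u u0 ->; lra.
  exact: arith.
have iT : inner_approx (m := nu) (cpt := cpt) setT by rewrite -setXTT; exact: iX.
pose G : set_system (borel X * borel X)%type :=
  [set A | [/\ measurable A, inner_approx (m := nu) (cpt := cpt) A &
    inner_approx (m := nu) (cpt := cpt) (~` A)]].
have sG : sigma_algebra setT G by exact: inner_regular_sigma_algebra.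
have sub : (@measurable _ (borel X * borel X)%type) `<=` G.
  rewrite measurable_prod_measurableType; apply: smallest_sub => //.
  move=> _ [A mA [B mB <-]]; split; [exact: measurableX|exact: iX|].
  have -> : ~` (A `*` B) = ((~` A) `*` setT) `|` (setT `*` (~` B)).
    apply/seteqP; split=> [[x y] /= h|[x y] /= [[nA _]|[_ nB]] []//].
    by have [Ax|nA] := pselect (A x); [right; split => // By; apply: h|left].
  have mA' := measurableC mA; have mB' := measurableC mB.
  by apply: inner_approxU; [| | | |exact: iX|exact: iX] => //; exact: measurableX.
by move=> A /sub[_ + _].
Qed.

End product.


(** * Transport plans on the cone *)

Section cone_plans.
Context {R : realType} {X : ptopologicalType} {d : X -> X -> \bar R}.
Hypothesis hd : ext_metric_topological d.
Hypothesis dX : separable_metric d.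
Hypothesis dtau : induced_by d.

Local Notation C := (cone d).
Local Notation CC := (C * C)%type.

Lemma cone_eq (p q : C) : cone_rad p = cone_rad q ->
  (0 < cone_rad p -> cone_base p = cone_base q) -> p = q.
Proof.
move=> rpq bpq.
have E (u : C) : u = cone_pt d (cone_rep u).1 (cone_rep u).2.
  by rewrite /cone_pt -surjective_pairing /cone_rep reprK.
rewrite (E p) (E q); apply/cone_ptE; rewrite /cone_rel -!surjective_pairing.
have [p0|p0] := ltP 0 (cone_rad p); last first.
  have pE : cone_rad p = 0 by apply/eqP; rewrite eq_le p0 cone_rad_ge0.
  apply/orP; right; apply/andP.
  by rewrite -[(cone_rep q).2%:num]/(cone_rad q) -[(cone_rep p).2%:num]/(cone_rad p) -rpq pE.
apply/orP; left; have := bpq p0; rewrite /cone_base -rpq p0 => b.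
apply/eqP; rewrite (surjective_pairing (cone_rep p)) (surjective_pairing (cone_rep q)) b.
by congr pair; apply/val_inj; exact: rpq.
Qed.

(** The radius separates points with different radii; points with the same
    positive radius are separated by their base points, which vary continuously
    away from the vertex. *)
Lemma cone_hausdorff : hausdorff_space C.
Proof.
move=> p q pq.
have rpq : cone_rad p = cone_rad q.
  apply: (@Rhausdorff R) => A B nA nB.
  have [|//|z [Az Bz]] := pq (@cone_rad R X d @^-1` A) (@cone_rad R X d @^-1` B).
  - exact: (cone_rad_continuous nA).
  - exact: (cone_rad_continuous nB).
  - by exists (cone_rad z).
apply: cone_eq => // p0; apply: (emt_hausdorff hd) => A B.
rewrite nbhsE => -[U [oU Up] UA]; rewrite nbhsE => -[V [oV Vq] VB].
have [||z [[_ Uz] [_ Vz]]] := pq [set p : C | 0 < cone_rad p /\ U (cone_base p)]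
    [set p : C | 0 < cone_rad p /\ V (cone_base p)].
- by apply: open_nbhs_nbhs; split; [exact: (cone_base_open hd dtau)|].
- by apply: open_nbhs_nbhs; split; [exact: (cone_base_open hd dtau)|rewrite /= -rpq].
- by exists (cone_base z); split; [exact: UA|exact: VB].
Qed.

Lemma cone_prod_hausdorff : hausdorff_space CC.
Proof. by apply: hausdorff_pair; exact: cone_hausdorff. Qed.

(** A value that the squared distance cannot exceed. The marginals are bare
    set functions so that plans can be added piece by piece, the pieces of the
    marginals being restrictions and multiples of given measures. *)
Definition HK_upper (mu nu : set (borel X) -> \bar R) (c : R) : Prop :=
  exists alpha : {measure set (borel CC) -> \bar R},
  [/\ (alpha setT < +oo)%E, inner_regular (T := CC) alpha,
      forall A, measurable A ->
        (\int[alpha]_(z in (fun z : CC => cone_base z.1 : borel X) @^-1` A)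
          (cone_rad z.1 ^+ 2)%:E = mu A)%E,
      forall A, measurable A ->
        (\int[alpha]_(z in (fun z : CC => cone_base z.2 : borel X) @^-1` A)
          (cone_rad z.2 ^+ 2)%:E = nu A)%E &
      (\int[alpha]_z (cone_dist z.1 z.2 ^+ 2)%:E <= c%:E)%E].

Let mrad1 : measurable_fun setT ((fun z : CC => cone_rad z.1 ^+ 2) : borel CC -> R).
Proof. by apply: measurable_funX; exact: borel_rad1. Qed.

Let mrad2 : measurable_fun setT ((fun z : CC => cone_rad z.2 ^+ 2) : borel CC -> R).
Proof. by apply: measurable_funX; exact: borel_rad2. Qed.

Let mbase1 (A : set (borel X)) : measurable A ->
  measurable ((fun z : borel CC => cone_base z.1 : borel X) @^-1` A).
Proof. by move=> mA; rewrite -[X in measurable X]setTI; exact: borel_base1. Qed.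

Let mbase2 (A : set (borel X)) : measurable A ->
  measurable ((fun z : borel CC => cone_base z.2 : borel X) @^-1` A).
Proof. by move=> mA; rewrite -[X in measurable X]setTI; exact: borel_base2. Qed.

Lemma integral_measure_addE {d'} {T : measurableType d'}
    (m n : {measure set T -> \bar R}) (D : set T) (f : T -> R) :
  measurable D -> measurable_fun setT f -> (forall x, 0 <= f x) ->
  (\int[measure_add m n]_(x in D) (f x)%:E =
   \int[m]_(x in D) (f x)%:E + \int[n]_(x in D) (f x)%:E)%E.
Proof.
move=> mD mf f0; apply: ge0_integral_measure_add => //.
- by move=> x _; rewrite lee_fin.
- by apply/measurable_EFinP; exact: measurable_funTS.
Qed.

Lemma measure_add_lty {d'} {T : measurableType d'} (m n : {measure set T -> \bar R}) :
  (m setT < +oo)%E -> (n setT < +oo)%E -> (measure_add m n setT < +oo)%E.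
Proof. by move=> mf nf; rewrite measure_addE; exact: lte_add_pinfty. Qed.

Lemma HK_upper_add mu nu c mu' nu' c' :
  HK_upper mu nu c -> HK_upper mu' nu' c' ->
  HK_upper (fun A => mu A + mu' A)%E (fun A => nu A + nu' A)%E (c + c').
Proof.
move=> [a [afin ar a1 a2 ac]] [b [bfin br b1 b2 bc]].
exists (measure_add a b); split.
- exact: measure_add_lty.
- exact: (inner_regular_add cone_prod_hausdorff).
- move=> A mA; rewrite -a1// -b1//.
  exact: (integral_measure_addE _ _ (mbase1 mA) mrad1 (fun z => sqr_ge0 _)).
- move=> A mA; rewrite -a2// -b2//.
  exact: (integral_measure_addE _ _ (mbase2 mA) mrad2 (fun z => sqr_ge0 _)).
- rewrite EFinD; apply: le_trans (leeD ac bc).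
  by rewrite (integral_measure_addE _ _ measurableT (borel_cone_dist hd dX dtau)
    (fun z => sqr_ge0 _)).
Qed.

Lemma HK_upper_eq mu nu c mu' nu' c' : HK_upper mu nu c ->
  (forall A, measurable A -> mu A = mu' A) ->
  (forall A, measurable A -> nu A = nu' A) -> c <= c' -> HK_upper mu' nu' c'.
Proof.
move=> [a [afin ar a1 a2 ac]] h1 h2 cc'; exists a; split => //.
- by move=> A mA; rewrite a1// h1.
- by move=> A mA; rewrite a2// h2.
- by apply: le_trans ac _; rewrite lee_fin.
Qed.

Lemma HK_upper0 : HK_upper (fun=> 0%E) (fun=> 0%E) 0.
Proof.
exists mzero; split.
- exact: (ltry 0).
- by move=> A mA e e0; exists set0; split; [exact: compact0|exact: sub0set|].
- by move=> A mA; rewrite integral_measure_zero.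
- by move=> A mA; rewrite integral_measure_zero.
- by rewrite integral_measure_zero.
Qed.

Lemma HK_upper_sum (I : finType) (mu nu : I -> set (borel X) -> \bar R) (c : I -> R) :
  (forall i, HK_upper (mu i) (nu i) (c i)) ->
  HK_upper (fun A => \sum_i mu i A)%E (fun A => \sum_i nu i A)%E (\sum_i c i).
Proof.
move=> h; elim: (index_enum I) => [|i s IH].
  apply: (HK_upper_eq HK_upper0) => [A _|A _|]; by rewrite big_nil.
apply: (HK_upper_eq (HK_upper_add (h i) IH)) => [A _|A _|]; by rewrite big_cons.
Qed.

(** The elementary plan: the product of two measures concentrated on [A] and
    [B], pushed to the fixed radii [r] and [s]. It transports when both radii are
    positive, and a zero radius sends the other marginal to the vertex. *)
Lemma HK_upper_prod (rho sigma : {finite_measure set (borel X) -> \bar R})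
    (r s : {nonneg R}) (A B : set (borel X)) (c : R) :
  radon rho -> radon sigma -> measurable A -> measurable B ->
  rho (~` A) = 0%E -> sigma (~` B) = 0%E ->
  (forall x y, A x -> B y -> r%:num ^+ 2 + s%:num ^+ 2
    - 2 * r%:num * s%:num * cos (dtrunc d pi x y) <= c) -> 0 <= c ->
  HK_upper (fun E => (r%:num ^+ 2)%:E * (rho E * sigma setT))%E
    (fun E => (s%:num ^+ 2)%:E * (rho setT * sigma E))%E
    (c * (fine (rho setT) * fine (sigma setT))).
Proof.
move=> rrho rsigma mA mB rhoA sigmaB cAB c0.
pose nu : {measure set (borel X * borel X)%type -> \bar R} := (rho \x sigma)%E.
have nuE (E F : set (borel X)) : measurable E -> measurable F ->
    nu (E `*` F) = (rho E * sigma F)%E.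
  by move=> mE mF; exact: product_measure1E.
pose T (z : X * X) : CC := (cone_pt d z.1 r, cone_pt d z.2 s).
have cT : continuous T by exact: (@cone_pair_continuous _ _ _ hd dtau r s).
have mT : measurable_fun setT (T : (borel X * borel X)%type -> borel CC).
  exact: (@continuous_prod_borel _ _ _ hd dX dtau CC T cT).
have [alpha [alphaE intE]] := pushforward_measure_ex nu mT.
have fr := fin_num_measure rho _ (@measurableT _ _).
have fs := fin_num_measure sigma _ (@measurableT _ _).
have nuT : nu setT = (rho setT * sigma setT)%E by rewrite -setXTT nuE.
exists alpha; split.
- by rewrite alphaE preimage_setT nuT ltey_eq fin_numM.
- move=> E mE e e0.
  have mTE : measurable ((T : (borel X * borel X)%type -> borel CC) @^-1` E).
    by rewrite -[X in measurable X]setTI; exact: mT.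
  have [K [cK KE nK]] := product_inner_regular hd dX dtau rrho rsigma mTE e0.
  have cTK : compact (T @` K).
    by apply: continuous_compact => //; exact: continuous_subspaceT.
  exists (T @` K); split => //; first by move=> _ [z Kz <-]; exact: KE.
  rewrite alphaE; apply: le_lt_trans nK.
  have mTK := compact_borel cone_prod_hausdorff cTK.
  have mK : measurable (K : set (borel X * borel X)%type).
    have hXX := hausdorff_pair (emt_hausdorff hd) (emt_hausdorff hd).
    rewrite -[K]setCK; apply: measurableC; apply: (open_measurable_prod hd dX dtau).
    by apply: closed_openC; exact: compact_closed.
  apply: le_measure; rewrite ?inE.
  + by rewrite -[X in measurable X]setTI; apply: mT => //; exact: measurableD.
  + exact: measurableD.
  + by move=> z [Ez nTK]; split => // Kz; apply: nTK; exists z.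
- move=> E mE; rewrite (intE _ _ (mbase1 mE) mrad1 (fun z => sqr_ge0 _)).
  have -> : (fun x : X * X => (cone_rad (T x).1 ^+ 2)%:E) = cst (r%:num ^+ 2)%:E.
    by apply/funext => x; rewrite /T /= cone_rad_pt.
  rewrite integral_cst; last first.
    by rewrite -[X in measurable X]setTI; apply: mT => //; exact: mbase1.
  have [r0|r0] := ltP 0 r%:num; last first.
    have -> : r%:num = 0 by apply/eqP; rewrite eq_le r0/=.
    by rewrite expr0n/= !mul0e.
  congr (_ * _)%E; rewrite -nuE//; congr (nu _).
  apply/seteqP; split => [[x y]|[x y] [/= Ex _]]; rewrite /T /= cone_base_pt//.
- move=> E mE; rewrite (intE _ _ (mbase2 mE) mrad2 (fun z => sqr_ge0 _)).
  have -> : (fun x : X * X => (cone_rad (T x).2 ^+ 2)%:E) = cst (s%:num ^+ 2)%:E.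
    by apply/funext => x; rewrite /T /= cone_rad_pt.
  rewrite integral_cst; last first.
    by rewrite -[X in measurable X]setTI; apply: mT => //; exact: mbase2.
  have [s0|s0] := ltP 0 s%:num; last first.
    have -> : s%:num = 0 by apply/eqP; rewrite eq_le s0/=.
    by rewrite expr0n/= !mul0e.
  congr (_ * _)%E; rewrite -nuE//; congr (nu _).
  apply/seteqP; split => [[x y]|[x y] [/= _ Ey]]; rewrite /T /= cone_base_pt//.
- have mD := borel_cone_dist hd dX dtau.
  rewrite (intE _ _ measurableT mD (fun z => sqr_ge0 _)) preimage_setT.
  have mDT : measurable_fun setT
     ((fun z => (cone_dist (T z).1 (T z).2 ^+ 2)%:E) : (borel X * borel X)%type -> \bar R).
    apply/measurable_EFinP; exact: (measurableT_comp mD mT).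
  have mN : measurable (~` (A `*` B)) by apply: measurableC; exact: measurableX.
  have N0 : nu (~` (A `*` B)) = 0%E.
    have mP : measurable ((~` A) `*` [set: borel X]).
      by apply: measurableX => //; exact: measurableC.
    have mQ : measurable ([set: borel X] `*` (~` B)).
      by apply: measurableX => //; exact: measurableC.
    apply/eqP; rewrite eq_le measure_ge0 andbT.
    apply: (@le_trans _ _ (nu (((~` A) `*` setT) `|` (setT `*` (~` B))))).
      apply: le_measure; rewrite ?inE//; first exact: measurableU.
      move=> [x y] /= h; have [Ax|nA] := pselect (A x); last by left.
      by right; split => // By; apply: h.
    apply: (le_trans (measureU_le nu mP mQ)).
    have mA' := measurableC mA; have mB' := measurableC mB.
    by rewrite !nuE// rhoA sigmaB mul0e mule0 adde0.
  rewrite (ge0_negligible_integral mN measurableT mDT _ N0); last first.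
    by move=> z _; rewrite lee_fin sqr_ge0.
  rewrite setTD setCK; apply: (@le_trans _ _ (\int[nu]_(z in A `*` B) (cst c%:E z))%E).
    apply: ge0_le_integral.
    + exact: measurableX.
    + by move=> z _; rewrite lee_fin sqr_ge0.
    + exact: measurable_funTS.
    + exact: measurable_cst.
    + move=> [x y] [/= Ax By]; rewrite lee_fin cone_dist_pt sqr_sqrtr; first exact: cAB.
      have rs0 : 0 <= 2 * r%:num * s%:num by rewrite !mulr_ge0.
      have := ler_wpM2l rs0 (cos_le1 (dtrunc d pi x y)).
      have := sqr_ge0 (r%:num - s%:num); lra.
  rewrite integral_cst; last exact: measurableX.
  rewrite EFinM; apply: lee_wpmul2l; first by rewrite lee_fin.
  rewrite EFinM !fineK// nuE//; apply: lee_pmul => //.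
    by apply: le_measure; rewrite ?inE.
  by apply: le_measure; rewrite ?inE.
Qed.

End cone_plans.

Arguments HK_upper {R X} d mu nu c.


Section cells.
Context {R : realType} {X : ptopologicalType} {d : X -> X -> \bar R}.
Hypothesis hd : ext_metric_topological d.
Hypothesis dX : separable_metric d.
Hypothesis dtau : induced_by d.

Local Notation C := (cone d).
Local Notation CC := (C * C)%type.

Lemma HK2_le (mu0 mu1 : {finite_measure set (borel X) -> \bar R}) (c : R) :
  HK_upper d mu0 mu1 c -> (HK2 d mu0 mu1 <= c%:E)%E.
Proof.
move=> [a [afin ar a1 a2 ac]].
have [b bE] := finite_measure_ex afin.
have intE (D : set (borel CC)) (f : borel CC -> \bar R) :
    (\int[b]_(z in D) f z = \int[a]_(z in D) f z)%E.
  by apply: eq_measure_integral => A mA _; exact: bE.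
apply: le_trans ac; rewrite -(intE setT); apply: ereal_inf_lbound.
exists b => //; split.
- move=> A mA e e0; have [K [cK KA mK]] := ar A mA e e0.
  by exists K; split => //; rewrite bE.
- have mr1 : measurable_fun setT ((fun z : CC => cone_rad z.1 ^+ 2) : borel CC -> R).
    by apply: measurable_funX; exact: borel_rad1.
  have mr2 : measurable_fun setT ((fun z : CC => cone_rad z.2 ^+ 2) : borel CC -> R).
    by apply: measurable_funX; exact: borel_rad2.
  have E1 := a1 setT measurableT; have E2 := a2 setT measurableT.
  rewrite intE (_ : (\int[a]_z _)%E = (mu0 setT + mu1 setT)%E).
    by rewrite ltey_eq fin_numD !fin_num_measure.
  rewrite -E1 -E2 !preimage_setT -ge0_integralD//.
  + by move=> z _; rewrite lee_fin sqr_ge0.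
  + exact/measurable_EFinP.
  + by move=> z _; rewrite lee_fin sqr_ge0.
  + exact/measurable_EFinP.
- by move=> A mA; rewrite /homogeneous_marginal1 /pushforward intE; exact: a1.
- by move=> A mA; rewrite /homogeneous_marginal2 /pushforward intE; exact: a2.
Qed.

Section restricted.
Context {mu0 mu1 : {finite_measure set (borel X) -> \bar R}}.
Hypothesis r0 : radon mu0.
Hypothesis r1 : radon mu1.
Context {A B : set (borel X)}.
Hypothesis mA : measurable A.
Hypothesis mB : measurable B.

Let rho : {finite_measure set (borel X) -> \bar R} := mrestr mu0 mA.
Let sigma : {finite_measure set (borel X) -> \bar R} := mrestr mu1 mB.
Let rrho : radon rho.
Proof. exact: (inner_regular_restr mA (emt_hausdorff hd) r0). Qed.
Let rsigma : radon sigma.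
Proof. exact: (inner_regular_restr mB (emt_hausdorff hd) r1). Qed.
Let rhoN : rho (~` A) = 0%E.
Proof. by rewrite /rho /= /mrestr setICl measure0. Qed.
Let sigmaN : sigma (~` B) = 0%E.
Proof. by rewrite /sigma /= /mrestr setICl measure0. Qed.
Let rhoT : rho setT = mu0 A. Proof. by rewrite /rho /= /mrestr setTI. Qed.
Let sigmaT : sigma setT = mu1 B. Proof. by rewrite /sigma /= /mrestr setTI. Qed.

Let delta : {finite_measure set (borel X) -> \bar R} := \d_ (point : borel X).
Let rdelta : radon delta.
Proof. exact: (inner_regular_dirac point (emt_hausdorff hd)). Qed.
Let deltaT : delta setT = 1%E. Proof. by rewrite /delta /= diracT. Qed.

(** Sending a mass to the vertex costs that mass; the second factor of the
    product plan is an arbitrary Dirac mass, put at radius zero. *)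
Lemma HK_upper_vertex1 (t : R) : 0 <= t ->
  HK_upper d (fun E => t%:E * mu0 (E `&` A))%E (fun=> 0%E) (t * fine (mu0 A)).
Proof.
move=> t0; have st : Num.sqrt t ^+ 2 = t by rewrite sqr_sqrtr.
apply: (HK_upper_eq (@HK_upper_prod _ _ _ hd dX dtau rho delta
  (NngNum (sqrtr_ge0 t)) 0%:nng A setT t rrho rdelta mA measurableT rhoN _ _ t0)).
- by rewrite setCT measure0.
- by move=> x y _ _ /=; rewrite st expr0n/= !(mulr0, mul0r) subr0 addr0.
- by move=> E mE /=; rewrite st deltaT mule1.
- by move=> E mE /=; rewrite expr0n/= mul0e.
- by rewrite rhoT deltaT mulr1.
Qed.

Lemma HK_upper_vertex2 (u : R) : 0 <= u ->
  HK_upper d (fun=> 0%E) (fun E => u%:E * mu1 (E `&` B))%E (u * fine (mu1 B)).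
Proof.
move=> u0; have su : Num.sqrt u ^+ 2 = u by rewrite sqr_sqrtr.
apply: (HK_upper_eq (@HK_upper_prod _ _ _ hd dX dtau delta sigma
  0%:nng (NngNum (sqrtr_ge0 u)) setT B u rdelta rsigma measurableT mB _ sigmaN _ u0)).
- by rewrite setCT measure0.
- by move=> x y _ _ /=; rewrite su expr0n/= !(mulr0, mul0r) subr0 add0r.
- by move=> E mE /=; rewrite expr0n/= mul0e.
- by move=> E mE /=; rewrite su deltaT mul1e.
- by rewrite sigmaT deltaT mul1r.
Qed.

(** The radii are chosen so that the product of the two restricted measures
    receives the marginal masses [a] and [b]. When [c <= 0],
    sending both masses to the vertex costs [a + b], which is not more. *)
Lemma HK_upper_cell (a b c : R) : (0 < mu0 A)%E -> (0 < mu1 B)%E ->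
  0 <= a -> 0 <= b -> c <= 1 ->
  (forall x y, A x -> B y -> c <= Num.max 0 (cos (dtrunc d pi x y))) ->
  HK_upper d (fun E => (a / fine (mu0 A))%:E * mu0 (E `&` A))%E
    (fun E => (b / fine (mu1 B))%:E * mu1 (E `&` B))%E
    (a + b - 2 * (c * Num.sqrt (a * b))).
Proof.
move=> A0 B0 a0 b0 c1 cAB.
have fA := fin_num_measure mu0 _ mA; have fB := fin_num_measure mu1 _ mB.
set m := fine (mu0 A); set n := fine (mu1 B).
have m0 : 0 < m by rewrite /m fine_gt0// A0/= ltey_eq fA.
have n0 : 0 < n by rewrite /n fine_gt0// B0/= ltey_eq fB.
have am0 : 0 <= a / m by rewrite divr_ge0// ltW.
have bn0 : 0 <= b / n by rewrite divr_ge0// ltW.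
have [c0|c0] := leP c 0.
  apply: (HK_upper_eq (HK_upper_add hd dX dtau (HK_upper_vertex1 am0) (HK_upper_vertex2 bn0))).
  - by move=> E mE; rewrite adde0.
  - by move=> E mE; rewrite add0e.
  - rewrite -/m -/n !divfK ?gt_eqF// lerDl oppr_ge0 mulr_ge0_le0//.
    by rewrite mulr_le0_ge0// sqrtr_ge0.
pose P := m * n; have P0 : 0 < P by exact: mulr_gt0.
pose r := Num.sqrt (a / P); pose s := Num.sqrt (b / P).
have r2 : r ^+ 2 = a / P by rewrite sqr_sqrtr// divr_ge0// ltW.
have s2 : s ^+ 2 = b / P by rewrite sqr_sqrtr// divr_ge0// ltW.
have rs : r * s = Num.sqrt (a * b) / P.
  rewrite /r /s -sqrtrM ?divr_ge0 ?(ltW P0)// mulf_div -expr2.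
  by rewrite sqrtrM ?mulr_ge0// sqrtrV ?exprn_ge0 ?(ltW P0)// sqrtr_sqr gtr0_norm.
have K0 : 0 <= r ^+ 2 + s ^+ 2 - 2 * r * s * c.
  have rs0 : 0 <= 2 * r * s by rewrite !mulr_ge0 ?sqrtr_ge0.
  have := ler_wpM2l rs0 c1; have := sqr_ge0 (r - s); lra.
apply: (HK_upper_eq (@HK_upper_prod _ _ _ hd dX dtau rho sigma
  (NngNum (sqrtr_ge0 (a / P))) (NngNum (sqrtr_ge0 (b / P))) A B _
  rrho rsigma mA mB rhoN sigmaN _ K0)).
- move=> x y Ax By; rewrite -/r -/s lerB// ler_wpM2l ?mulr_ge0 ?sqrtr_ge0//.
  by have := cAB x y Ax By; rewrite le_max leNgt c0.
- move=> E mE /=; rewrite -/r r2 sigmaT -[mu1 B](fineK fB) -/n.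
  rewrite [X in (_ * X)%E]muleC muleA -EFinM /rho /= /mrestr; congr (_%:E * _)%E.
  by rewrite /P; field; rewrite !gt_eqF.
- move=> E mE /=; rewrite -/s s2 rhoT -[mu0 A](fineK fA) -/m.
  rewrite muleA -EFinM /sigma /= /mrestr; congr (_%:E * _)%E.
  by rewrite /P; field; rewrite !gt_eqF.
- rewrite rhoT sigmaT -/m -/n -/P r2 s2 -(mulrA 2) rs.
  rewrite le_eqVlt; apply/orP; left; apply/eqP; field; rewrite gt_eqF//.
Qed.

End restricted.

(** * Small cells *)

(** Balls of radius [delta] around a dense sequence cover the space, and
    finitely many of them carry all the mass up to [e]. Disjointness is obtained
    by removing the previous balls; cells of mass zero are dropped because the
    masses serve as denominators. *)
Lemma cells_exist (mu : {finite_measure set (borel X) -> \bar R}) (delta e : R) :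
  0 < delta -> 0 < e ->
  exists (I : finType) (A : I -> set (borel X)) (x : I -> X),
    [/\ forall i, measurable (A i), trivIset setT A,
        forall i, (0 < mu (A i))%E, forall i, A i `<=` dball d (x i) delta &
        (mu (~` \bigcup_i A i) < e%:E)%E].
Proof.
move=> delta0 e0; have [g gd] := dense_sequence hd dX dtau.
pose B (k : nat) : set (borel X) := dball d (g k) delta.
have mB k : measurable (B k) by apply: open_borel; exact: dball_open.
pose A' := seqDU B.
have mA' k : measurable (A' k).
  by apply: measurableD => //; exact: bigsetU_measurable.
pose V N := \big[setU/set0]_(k < N) A' k.
have mV N : measurable (V N) by exact: bigsetU_measurable.
have cov : \bigcup_k A' k = setT.
  rewrite -seqDU_bigcup_eq -subTset => x _; have [k xk] := gd x _ delta0.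
  by exists k.
have h2 : (mu \o (fun N => ~` V N)) N @[N --> \oo] --> (0 : \bar R)%E.
  have -> : (0 : \bar R)%E = mu (\bigcap_N (~` V N)).
    rewrite (_ : \bigcap_N _ = set0) ?measure0// -subset0 => x h.
    have [k _ Ak] : (\bigcup_k A' k) x by rewrite cov.
    by have := h k.+1 I; apply; rewrite /V -bigcup_mkord; exists k => /=.
  apply: nonincreasing_cvg_mu.
  - by rewrite ltey_eq fin_num_measure//; exact: measurableC.
  - by move=> n; exact: measurableC.
  - by apply: bigcapT_measurable => n; exact: measurableC.
  - move=> a b ab; apply/subsetPset; apply: subsetC.
    rewrite /V -!bigcup_mkord; apply: bigcup_subset => i /= ib.
    exact: leq_trans ib ab.
have [|N _ hN] := h2 [set x | (x < e%:E)%E].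
  by apply: open_nbhs_nbhs; split; [exact: open_ereal_lt_ereal|rewrite /= lte_fin].
have muN : (mu (~` V N) < e%:E)%E by apply: (hN N) => /=.
pose I : finType := {k : 'I_N | (0 < mu (A' k))%E}.
pose A (i : I) := A' (val i).
exists I; exists A; exists (fun i : I => g (val (val i))); split.
- by move=> i; exact: mA'.
- move=> i j _ _ ij; apply/val_inj/val_inj; apply: (trivIset_seqDU B) => //.
- by move=> i; exact: (valP i).
- by move=> i; exact: subset_seqDU.
apply: le_lt_trans muN.
pose Z k := if (0 < mu (A' k))%E then set0 else A' k.
have mZ k : measurable (Z k) by rewrite /Z; case: ifP.
have Z0 k : mu (Z k) = 0%E.
  rewrite /Z; case: ifPn; first by rewrite measure0.
  by rewrite -leNgt => h; apply/eqP; rewrite eq_le h measure_ge0.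
have mUA : measurable (\bigcup_i A i).
  by apply: fin_bigcup_measurable => // i _; exact: mA'.
apply: (@le_trans _ _ (mu (~` V N `|` \big[setU/set0]_(k < N) Z k))).
  apply: le_measure; rewrite ?inE.
  - exact: measurableC.
  - apply: measurableU; [exact: measurableC|exact: bigsetU_measurable].
  - move=> x nA; have [Vx|nV] := pselect (V N x); last by left.
    right; move: Vx; rewrite /V -!bigcup_mkord => -[k /= kN Ak].
    exists k => //; rewrite /Z; case: ifPn => // pk; exfalso; apply: nA.
    by exists (exist _ (Ordinal kN) pk : I).
apply: (le_trans (measureU_le mu (measurableC (mV N)) (bigsetU_measurable _ _))) => //.
rewrite [X in (_ + X)%E](_ : _ = 0%E) ?adde0//.
apply/eqP; rewrite eq_le measure_ge0 andbT.
apply: (le_trans (Boole_inequality mu _)) => //.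
by rewrite big1 => [|k _]//; exact: Z0.
Qed.

Lemma cells_decomposition (mu : {finite_measure set (borel X) -> \bar R})
    (I : finType) (A : I -> set (borel X)) (E : set (borel X)) :
  (forall i, measurable (A i)) -> trivIset setT A -> measurable E ->
  (mu E = \sum_i mu (E `&` A i) + mu (E `&` ~` \bigcup_i A i))%E.
Proof.
move=> mA tA mE.
have mU : measurable (\bigcup_i A i) by exact: fin_bigcup_measurable.
have mEA i : measurable (E `&` A i) by exact: measurableI.
have -> : (\sum_i mu (E `&` A i) = mu (\bigcup_i (E `&` A i)))%E.
  rewrite (@measure_fin_bigcup _ _ _ mu I setT (fun i => E `&` A i)) //; last 2 first.
  - exact: finite_finset.
  - exact: trivIset_setIl.
  rewrite fsbig_seq ?index_enum_uniq//.
  suff -> : [set` index_enum I] = [set: I] by [].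
  by apply/seteqP; split => i //= _; rewrite mem_index_enum.
rewrite -measureU//.
- by rewrite -setI_bigcupr -setIUr setUv setIT.
- exact: fin_bigcup_measurable.
- by apply: measurableI => //; exact: measurableC.
- by rewrite -setI_bigcupr setIACA setICr setI0.
Qed.

Lemma integral_cells_le {d'} {T : measurableType d'}
    (mu : {finite_measure set T -> \bar R})
    (I : finType) (A : I -> set T) (f : T -> R) (v : I -> R) (K : R) :
  (forall i, measurable (A i)) -> measurable_fun setT f -> (forall x, 0 <= f x) ->
  (forall i, 0 <= v i) -> 0 <= K ->
  (forall i x, A i x -> f x <= v i) -> (forall x, f x <= K) ->
  (\int[mu]_x (f x)%:E <=
    (\sum_i fine (mu (A i)) * v i + K * fine (mu (~` \bigcup_i A i)))%:E)%E.
Proof.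
move=> mA mf f0 v0 K0 fv fK.
have mU : measurable (\bigcup_i A i) by exact: fin_bigcup_measurable.
have mN := measurableC mU; set N := ~` _ in mN *.
pose s x := \sum_i v i * \1_(A i) x + K * \1_N x.
have mI (B : set T) (c : R) : measurable B -> measurable_fun setT (fun x => c * \1_B x).
  by move=> mB; apply: measurable_funM.
have ms : measurable_fun setT s.
  by apply: measurable_funD; [apply: measurable_sum => i; exact: mI|exact: mI].
have fs x : f x <= s x.
  have [[i _ Ai]|nU] := pselect ((\bigcup_i A i) x).
    rewrite /s (bigD1 i)//= indicE mem_set// mulr1.
    apply: (le_trans (fv i x Ai)); rewrite -addrA lerDl addr_ge0//.
      by apply: sumr_ge0 => j _; rewrite mulr_ge0.
    by rewrite mulr_ge0.
  rewrite /s [\1_N x]indicE mem_set// mulr1; apply: (le_trans (fK x)).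
  by rewrite lerDr; apply: sumr_ge0 => j _; rewrite mulr_ge0.
apply: (@le_trans _ _ (\int[mu]_x (s x)%:E)%E).
  apply: ge0_le_integral => //.
  - by move=> x _; rewrite lee_fin.
  - exact/measurable_EFinP.
  - exact/measurable_EFinP.
  - by move=> x _; rewrite lee_fin.
rewrite le_eqVlt; apply/orP; left; apply/eqP.
have intc (B : set T) (c : R) : measurable B -> 0 <= c ->
    (\int[mu]_x (c * \1_B x)%:E = (c * fine (mu B))%:E)%E.
  move=> mB c0; under eq_integral do rewrite EFinM.
  rewrite ge0_integralZl_EFin//; last first.
    by apply/measurable_EFinP; exact: measurable_indic.
  by rewrite integral_indic// setIT EFinM fineK// fin_num_measure.
under eq_integral do rewrite EFinD -sumEFin.
rewrite ge0_integralD//; last 4 first.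
- by move=> x _; apply: sume_ge0 => i _; rewrite lee_fin mulr_ge0.
- apply: emeasurable_sum => i; apply/measurable_EFinP.
  exact: mI.
- by move=> x _; rewrite lee_fin mulr_ge0.
- by apply/measurable_EFinP; exact: mI.
rewrite ge0_integral_sum//; last 2 first.
- by move=> i; apply/measurable_EFinP; exact: mI.
- by move=> i x _; rewrite lee_fin mulr_ge0.
rewrite intc// EFinD -sumEFin; congr (_ + _)%E.
by apply: eq_bigr => i _; rewrite intc// mulrC.
Qed.

End cells.


(** * Lifting the finite dual potential *)

Section truncated_cosine.
Context {R : realType}.
Implicit Types s t : R.

(** Clamping the argument makes the cosine of the truncated distance an
    antitone Lipschitz function on the whole line, so that an error on a
    distance is absorbed by a shift of the argument, possibly below zero. *)
Definition tcos t : R := cos (Num.min (Num.max 0 t) (pi / 2)).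

Let clamp_ge0 t : 0 <= Num.min (Num.max 0 t) (pi / 2).
Proof. by rewrite le_min le_max lexx divr_ge0 ?pi_ge0. Qed.

Let clamp_le t : Num.min (Num.max 0 t) (pi / 2) <= pi / 2.
Proof. by rewrite ge_min lexx orbT. Qed.

Lemma pihalf_le_pi : pi / 2 <= pi :> R.
Proof. have := pi_ge0 R; lra. Qed.

Lemma tcos_ge0 t : 0 <= tcos t.
Proof.
apply: cos_ge0_pihalf; rewrite clamp_le andbT (le_trans _ (clamp_ge0 t))//.
by rewrite oppr_le0 divr_ge0 ?pi_ge0.
Qed.

Lemma tcos_le1 t : tcos t <= 1. Proof. exact: cos_le1. Qed.

Lemma tcos_antitone s t : s <= t -> tcos t <= tcos s.
Proof.
move=> st; apply: cos_antitone; [exact: clamp_ge0| |].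
  by rewrite le_min ge_min clamp_le andbT; apply/orP; left; rewrite ge_max !le_max lexx st orbT.
exact: le_trans (clamp_le _) pihalf_le_pi.
Qed.

Lemma clamp_lipschitz s t : `|Num.min (Num.max 0 s) (pi / 2) - Num.min (Num.max 0 t) (pi / 2)|
  <= `|s - t|.
Proof.
have P0 : 0 <= pi / 2 :> R by rewrite divr_ge0 ?pi_ge0.
wlog st : s t / s <= t => [hw|].
  by case: (leP s t) => [/hw//|/ltW/hw]; rewrite distrC [leRHS]distrC.
rewrite distrC [leRHS]distrC [leRHS]ger0_norm ?subr_ge0//.
rewrite ger0_norm; last first.
  by rewrite subr_ge0 le_min ge_min clamp_le andbT; apply/orP; left;
    rewrite ge_max !le_max lexx st orbT.
rewrite !minEle !maxEle; do !case: ifPn; rewrite -?ltNge => *; lra.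
Qed.

Lemma tcos_lipschitz s t : `|tcos s - tcos t| <= `|s - t|.
Proof. exact: le_trans (cos_lipschitz _ _) (clamp_lipschitz _ _). Qed.

Lemma tcos_far t : pi / 2 <= t -> tcos t = 0.
Proof.
move=> pt; rewrite /tcos min_r ?cos_pihalf// le_max pt orbT//.
Qed.

Lemma tcos_sq_le s t : s <= t -> tcos t ^+ 2 <= tcos s ^+ 2.
Proof. by move=> st; rewrite lerXn2r ?nnegrE ?tcos_ge0// tcos_antitone. Qed.

Lemma tcos_sq_lipschitz s t : `|tcos s ^+ 2 - tcos t ^+ 2| <= 2 * `|s - t|.
Proof.
rewrite subr_sqr normrM mulrC ler_pM//; last exact: tcos_lipschitz.
rewrite ger0_norm ?addr_ge0 ?tcos_ge0//.
have := tcos_le1 s; have := tcos_le1 t; lra.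
Qed.

Lemma maxr_lipschitz (a b a' b' e : R) : `|a - a'| <= e -> `|b - b'| <= e ->
  `|Num.max a b - Num.max a' b'| <= e.
Proof.
rewrite !ler_norml => /andP[? ?] /andP[? ?].
by rewrite !maxEle; do !case: ifPn; rewrite -?ltNge => *; lra.
Qed.

Lemma bigmax_lipschitz (J : finType) (a b : J -> R) (k e : R) : 0 <= e ->
  (forall j, `|a j - b j| <= e) ->
  `|\big[Num.max/k]_j a j - \big[Num.max/k]_j b j| <= e.
Proof.
move=> e0 h; elim/big_ind2: _ => // [|x1 x2 y1 y2]; first by rewrite subrr normr0.
exact: maxr_lipschitz.
Qed.

End truncated_cosine.

Section potential.
Context {R : realType} {X : ptopologicalType} {d : X -> X -> \bar R}.
Hypothesis hd : ext_metric_topological d.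
Hypothesis dX : separable_metric d.
Hypothesis dtau : induced_by d.

Definition rdist (d' : X -> X -> \bar R) (x y : X) : R := fine (d' x y).
Local Notation D := (rdist d).

Lemma rdistE x y : d x y = (D x y)%:E.
Proof. exact: (dist_fin hd dX). Qed.

Lemma rdist_ge0 x y : 0 <= D x y.
Proof. by rewrite -lee_fin -rdistE (emt_ge0 hd). Qed.

Lemma rdist_sym x y : D x y = D y x.
Proof. by rewrite /rdist (emt_sym hd). Qed.

Lemma rdist_triangle x y z : D x z <= D x y + D y z.
Proof. by rewrite -lee_fin EFinD -!rdistE (emt_triangle hd). Qed.

Lemma rdist_lipschitz x y z : `|D x z - D y z| <= D x y.
Proof.
rewrite ler_norml; have := rdist_triangle x y z; have := rdist_triangle y x z.
rewrite (rdist_sym y x); lra.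
Qed.

Lemma dtrunc_rdist a x y : dtrunc d a x y = Num.min (D x y) a.
Proof. by rewrite /dtrunc rdistE -EFin_min. Qed.

Lemma cos_dtrunc_tcos x y : cos (dtrunc d (pi / 2) x y) = tcos (D x y).
Proof. by rewrite dtrunc_rdist /tcos (max_r (rdist_ge0 x y)). Qed.

Lemma tcos_le_cos x y : tcos (D x y) <= Num.max 0 (cos (dtrunc d pi x y)).
Proof.
have [h|h] := leP (pi / 2) (D x y); first by rewrite tcos_far// le_max lexx.
rewrite le_max; apply/orP; right; rewrite dtrunc_rdist /tcos max_r ?rdist_ge0//.
rewrite !min_l ?(ltW h)//; exact: le_trans (ltW h) (pihalf_le_pi).
Qed.

Section construction.
Context {I J : finType} {A : I -> set X} {B : J -> set X} {x : I -> X} {y : J -> X}.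
Context {delta kappa : R} {u : I -> R} {v : J -> R}.
Hypothesis delta0 : 0 < delta.
Hypothesis kappa0 : 0 < kappa.
Hypothesis kappa1 : kappa <= 1.
Hypothesis Ax : forall i, A i `<=` dball d (x i) delta.
Hypothesis By : forall j, B j `<=` dball d (y j) delta.
Hypothesis v0 : forall j, 0 < v j.
Hypothesis uv : forall i j, tcos (D (x i) (y j) - 2 * delta) ^+ 2 <= u i * v j.

Let radius : R := \sum_i D point (x i) + \sum_j D point (y j) + delta.
Let cutoff z : R := Num.min 1 (Num.max 0 (D point z - radius)).
Let bump j z : R := tcos (D z (y j) - delta) ^+ 2 / Num.max (v j) kappa.

(** This is [1 + 2 xi] for the potential [xi] under construction. For
    [1 - 2 P1 xi <= max (v j) kappa] to hold on [B j], it has to lie above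
    [cos ^ 2 d(z, -) / max (v j) kappa] for all [z] in [B j]: [bump j] is a
    majorant of these functions. The floor [kappa] keeps the weight positive,
    and the cutoff raises it to [1] far away so that [xi] has bounded support. *)
Definition dual_weight z : R :=
  Num.max (cutoff z) (\big[Num.max/kappa]_j bump j z).

Let vk0 j : 0 < Num.max (v j) kappa.
Proof. by rewrite lt_max v0. Qed.

Lemma dual_weight_ge z : kappa <= dual_weight z.
Proof. by rewrite /dual_weight le_max; apply/orP; right; exact: bigmax_ge_id. Qed.

Lemma dual_weight_le z : dual_weight z <= kappa^-1.
Proof.
have k1 : 1 <= kappa^-1 by rewrite invf_ge1.
rewrite /dual_weight ge_max; apply/andP; split.
  by rewrite (le_trans _ k1)// ge_min lexx.
apply: bigmax_le => [|j _]; first exact: le_trans kappa1 k1.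
rewrite /bump ler_pdivrMr// (@le_trans _ _ 1)//.
  by rewrite expr_le1 ?tcos_le1 ?tcos_ge0.
by rewrite mulrC ler_pdivlMr// mul1r le_max lexx orbT.
Qed.

Lemma cell_in_radius1 i z : A i z -> D point z <= radius.
Proof.
move=> /Ax; rewrite /dball /= rdistE lte_fin => xz.
apply: (le_trans (rdist_triangle point (x i) z)).
rewrite /radius (bigD1 i)//=.
have : 0 <= \sum_(k | k != i) D point (x k) by apply: sumr_ge0 => *; exact: rdist_ge0.
have : 0 <= \sum_j D point (y j) by apply: sumr_ge0 => *; exact: rdist_ge0.
lra.
Qed.

(** This is where the constraint [c i j ^ 2 <= u i v j] of the finite problem
    is used: on [A i] the bump [j] is at most [c i j ^ 2 / v j]. *)
Lemma dual_weight_cell i z : A i z -> dual_weight z <= Num.max (u i) kappa.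
Proof.
move=> Aiz; rewrite /dual_weight ge_max; apply/andP; split.
  rewrite /cutoff max_l; last by rewrite subr_le0 (cell_in_radius1 Aiz).
  by rewrite le_max min_r// (ltW kappa0) orbT.
apply: bigmax_le => [|j _]; first by rewrite le_max lexx orbT.
rewrite le_max; apply/orP; left; rewrite /bump ler_pdivrMr//.
apply: (@le_trans _ _ (u i * v j)).
  apply: le_trans (uv i j); apply: tcos_sq_le.
  have := Ax Aiz; rewrite /dball /= rdistE lte_fin => xz.
  have := rdist_triangle (x i) z (y j); lra.
have u0 : 0 <= u i.
  by rewrite -(pmulr_lge0 _ (v0 j)) (le_trans _ (uv i j)) ?sqr_ge0.
by rewrite ler_wpM2l// le_max lexx.
Qed.

Lemma dual_weight_bump j z w : B j z ->
  tcos (D z w) ^+ 2 / dual_weight w <= Num.max (v j) kappa.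
Proof.
move=> Bjz; have := By Bjz; rewrite /dball /= rdistE lte_fin => yz.
have W0 : 0 < dual_weight w := lt_le_trans kappa0 (dual_weight_ge w).
rewrite ler_pdivrMr// mulrC -ler_pdivrMr//.
apply: (@le_trans _ _ (bump j w)).
  rewrite /bump ler_wpM2r ?invr_ge0 ?(ltW (vk0 j))//; apply: tcos_sq_le.
  have := rdist_triangle w z (y j); rewrite (rdist_sym w z) (rdist_sym z (y j)); lra.
by rewrite /dual_weight le_max; apply/orP; right; exact: le_bigmax.
Qed.

Lemma dual_weight_lipschitz z w :
  `|dual_weight z - dual_weight w| <= 2 / kappa * D z w.
Proof.
have k1 : 1 <= kappa^-1 by rewrite invf_ge1.
have D0 := rdist_ge0 z w.
apply: maxr_lipschitz.
  have h : `|cutoff z - cutoff w| <= D z w.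
    have := rdist_lipschitz z w point; rewrite !(rdist_sym _ point) /cutoff.
    rewrite !ler_norml => /andP[? ?].
    rewrite !minEle !maxEle; do !case: ifPn; rewrite -?ltNge => *; lra.
  apply: (le_trans h); rewrite ler_peMl//; lra.
apply: bigmax_lipschitz => [|j]; first by rewrite mulr_ge0 ?divr_ge0 ?(ltW kappa0).
rewrite /bump -mulrBl normrM [`|_^-1|]ger0_norm ?invr_ge0 ?(ltW (vk0 j))//.
rewrite -mulrA [kappa^-1 * _]mulrC mulrA; apply: ler_pM => //.
  by rewrite invr_ge0 ltW.
- apply: (le_trans (tcos_sq_lipschitz _ _)); rewrite ler_wpM2l//.
  by rewrite opprB addrA subrK; exact: rdist_lipschitz.
- by rewrite lef_pV2 ?posrE// le_max lexx orbT.
Qed.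

(** Beyond distance [pi / 2] from all the cells the bumps vanish. *)
Lemma dual_weight_far z : radius + pi / 2 + delta + 1 <= D point z -> dual_weight z = 1.
Proof.
move=> far; have P0 := pi_ge0 R; rewrite /dual_weight.
have -> : cutoff z = 1.
  rewrite /cutoff min_l// le_max; apply/orP; right; move: delta0; lra.
rewrite max_l//; apply: bigmax_le => // j _; rewrite /bump tcos_far.
  by rewrite expr0n/= mul0r.
have : D point (y j) <= radius.
  rewrite /radius (bigD1 j)//=.
  have : 0 <= \sum_i D point (x i) by apply: sumr_ge0 => *; exact: rdist_ge0.
  have : 0 <= \sum_(k | k != j) D point (y k) by apply: sumr_ge0 => *; exact: rdist_ge0.
  move: delta0; lra.
have := rdist_triangle point (y j) z; rewrite (rdist_sym (y j)); lra.
Qed.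

Definition dual_potential z : R := (dual_weight z - 1) / 2.

Lemma dual_potentialK z : 1 + 2 * dual_potential z = dual_weight z.
Proof. by rewrite /dual_potential mulrC divfK// addrC subrK. Qed.

Lemma dual_potential_lbound z : kappa <= 1 + 2 * dual_potential z.
Proof. by rewrite dual_potentialK dual_weight_ge. Qed.

Lemma dual_potential_Lip_bs : Lip_bs d dual_potential.
Proof.
split; first split.
- exists (kappa^-1); split; first by rewrite num_real.
  move=> M hM z _ /=; apply: le_trans (ltW hM).
  have := dual_weight_le z; have := dual_weight_ge z.
  have k1 : 1 <= kappa^-1 by rewrite invf_ge1.
  move: kappa0; rewrite /dual_potential ler_norml; lra.
- exists (2 / kappa); first by rewrite divr_ge0 ?(ltW kappa0).
  move=> z w; rewrite rdistE -EFinM lee_fin.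
  apply: le_trans (dual_weight_lipschitz z w).
  rewrite /dual_potential -mulrBl opprB addrA subrK normrM.
  by rewrite [`|2^-1|]ger0_norm ?invr_ge0// ler_piMr// invf_le1// ler1n.
- apply: (dbounded_closure hd); pose M := radius + pi / 2 + delta + 1.
  have supp z : dual_potential z != 0 -> D point z <= M.
    move=> h; rewrite leNgt; apply/negP => /ltW /dual_weight_far E.
    by move: h; rewrite /dual_potential E subrr mul0r eqxx.
  exists (M + M) => z w /= /supp hz /supp hw; rewrite rdistE lee_fin.
  apply: (le_trans (rdist_triangle z point w)).
  by rewrite (rdist_sym z) lerD.
Qed.

Lemma dual_P1_ge0 z : 0 <= 1 - 2 * P1_real (d := d) dual_potential z.
Proof.
have := P1_real_lbound hd kappa0 dual_potential_lbound z z.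
have := P1_cost_le (d := d) kappa0 dual_potential_lbound z z; lra.
Qed.

Lemma dual_P1_le z : 1 - 2 * P1_real (d := d) dual_potential z <= kappa^-1.
Proof.
have := P1_real_glb hd kappa0 dual_potential_lbound
  (P1_cost_ge hd kappa0 dual_potential_lbound z).
lra.
Qed.

(** Each term of the infimum defining [P1] is controlled by the bump of the
    cell, by construction of the weight. *)
Lemma dual_P1_cell j z : B j z ->
  1 - 2 * P1_real (d := d) dual_potential z <= Num.max (v j) kappa.
Proof.
move=> Bjz.
have : 1 / 2 * (1 - Num.max (v j) kappa) <= P1_real (d := d) dual_potential z.
  apply: (P1_real_glb hd kappa0 dual_potential_lbound) => w; rewrite /P1_cost ler_wpM2l// lerB//.
  by rewrite cos_dtrunc_tcos dual_potentialK; exact: dual_weight_bump.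
lra.
Qed.

End construction.

End potential.




(** * Strong duality *)

Section bounded_integral.
Context {R : realType} {d' : measure_display} {T : measurableType d'}.
Variable mu : {finite_measure set T -> \bar R}.

Lemma integral_affine (f : T -> R) (M a b : R) : measurable_fun setT f ->
  (forall x, `|f x| <= M) ->
  (\int[mu]_x (a + b * f x)%:E =
   (a * fine (mu setT) + b * fine (\int[mu]_x (f x)%:E))%:E)%E /\
  (\int[mu]_x (f x)%:E)%E \is a fin_num.
Proof.
move=> mf fM.
have fin : mu.-integrable setT (EFin \o f).
  apply: (@le_integrable _ _ _ mu setT measurableT _ (EFin \o cst M)).
  - exact/measurable_EFinP.
  - move=> x _ /=; rewrite lee_fin.
    by apply: (le_trans (fM x)); exact: ler_norm.
  - exact: finite_measure_integrable_cst.
have If : (\int[mu]_x (f x)%:E)%E \is a fin_num by exact: (integrable_fin_num measurableT fin).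
split=> //.
under eq_integral do rewrite EFinD.
rewrite integralD//=.
- rewrite integral_cst// EFinD !EFinM fineK ?fin_num_measure//.
  congr (_ + _)%E; rewrite fineK//.
  under eq_integral do rewrite EFinM.
  exact: integralZl.
- exact: finite_measure_integrable_cst.
- under eq_fun do rewrite EFinM.
  exact: integrableZl.
Qed.

End bounded_integral.

(** The transported part and the part sent to the vertex add up to the whole
    mass, cell by cell. *)
Lemma marginal_recombine {R : realType} {I J : finType} {m : I -> R}
    {a : I -> J -> R} {p : I -> \bar R} :
  (forall i, 0 < m i) -> (forall i, p i \is a fin_num) ->
  (\sum_i \sum_j (a i j / m i)%:E * p i +
   \sum_i ((m i - \sum_j a i j) / m i)%:E * p i = \sum_i p i)%E.
Proof.
move=> m0 pfin; rewrite -big_split; apply: eq_bigr => i _ /=.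
rewrite -(fineK (pfin i)); under eq_bigr do rewrite -EFinM.
rewrite sumEFin -EFinM -EFinD -mulr_suml -mulr_suml -mulrDl -mulrDl.
by rewrite addrC subrK divff ?mul1r// gt_eqF.
Qed.

Lemma total_mass_cells {R : realType} {X : ptopologicalType}
    (mu : {finite_measure set (borel X) -> \bar R}) (K : finType)
    (C : K -> set (borel X)) : (forall i, measurable (C i)) -> trivIset setT C ->
  fine (mu setT) = \sum_i fine (mu (C i)) + fine (mu (~` \bigcup_i C i)).
Proof.
move=> mC tC; rewrite (cells_decomposition mu mC tC measurableT) setTI.
under eq_bigr do rewrite setTI.
have mR : measurable (~` \bigcup_i C i) by apply: measurableC; exact: fin_bigcup_measurable.
have fE E : measurable E -> mu E = (fine (mu E))%:E.
  by move=> mE; rewrite fineK// fin_num_measure.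
rewrite (fE _ mR) (eq_bigr (fun i => (fine (mu (C i)))%:E)); last by move=> i _; exact: fE.
by rewrite sumEFin.
Qed.

Section strong_duality.
Context {R : realType} {X : ptopologicalType} {d : X -> X -> \bar R}.
Hypothesis hd : ext_metric_topological d.
Hypothesis dX : separable_metric d.
Hypothesis dtau : induced_by d.
Context {mu0 mu1 : {finite_measure set (borel X) -> \bar R}}.
Hypothesis r0 : radon mu0.
Hypothesis r1 : radon mu1.
Context {I J : finType} {A : I -> set (borel X)} {B : J -> set (borel X)}.
Hypothesis mA : forall i, measurable (A i).
Hypothesis mB : forall j, measurable (B j).

Local Notation m i := (fine (mu0 (A i))).
Local Notation n j := (fine (mu1 (B j))).
Local Notation rest0 := (fine (mu0 (~` \bigcup_i A i))).
Local Notation rest1 := (fine (mu1 (~` \bigcup_j B j))).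
Local Notation total := (fine (mu0 setT) + fine (mu1 setT)).

Section primal.
Hypothesis tA : trivIset setT A.
Hypothesis tB : trivIset setT B.
Hypothesis A0 : forall i, (0 < mu0 (A i))%E.
Hypothesis B0 : forall j, (0 < mu1 (B j))%E.
Context {a b gamma : I -> J -> R}.
Hypothesis a0 : forall i j, 0 <= a i j.
Hypothesis b0 : forall i j, 0 <= b i j.
Hypothesis am : forall i, \sum_j a i j <= m i.
Hypothesis bn : forall j, \sum_i b i j <= n j.
Hypothesis g1 : forall i j, gamma i j <= 1.
Hypothesis gcos : forall i j x y, A i x -> B j y ->
  gamma i j <= Num.max 0 (cos (dtrunc d pi x y)).

Let mrest0 : measurable (~` \bigcup_i A i).
Proof. by apply: measurableC; exact: fin_bigcup_measurable. Qed.

Let mrest1 : measurable (~` \bigcup_j B j).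
Proof. by apply: measurableC; exact: fin_bigcup_measurable. Qed.

Let m0 i : 0 < m i. Proof. by rewrite fine_gt0// A0/= ltey_eq fin_num_measure. Qed.

Let n0 j : 0 < n j. Proof. by rewrite fine_gt0// B0/= ltey_eq fin_num_measure. Qed.

(** The plan moves [a i j] from [A i] onto [b i j] in [B j], and sends to the
    vertex both what the cells have left and what lies outside the cells. *)
Lemma HK2_le_cells :
  (HK2 d mu0 mu1 <=
   (total - 2 * \sum_i \sum_j gamma i j * Num.sqrt (a i j * b i j))%:E)%E.
Proof.
apply: HK2_le.
have pair i j := HK_upper_cell hd dX dtau r0 r1 (mA i) (mB j) (A0 i) (B0 j)
  (a0 i j) (b0 i j) (g1 i j) (gcos (i := i) (j := j)).
have pairs := HK_upper_sum hd dX dtau (fun i => HK_upper_sum hd dX dtau (pair i)).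
have t0 i : 0 <= (m i - \sum_j a i j) / m i.
  by rewrite divr_ge0 ?subr_ge0 ?am ?ltW.
have s0 j : 0 <= (n j - \sum_i b i j) / n j.
  by rewrite divr_ge0 ?subr_ge0 ?bn ?ltW.
have left0 := HK_upper_sum hd dX dtau
  (fun i => HK_upper_vertex1 hd dX dtau r0 (mA i) (t0 i)).
have left1 := HK_upper_sum hd dX dtau
  (fun j => HK_upper_vertex2 hd dX dtau r1 (mB j) (s0 j)).
have far0 := HK_upper_vertex1 hd dX dtau r0 mrest0 ler01.
have far1 := HK_upper_vertex2 hd dX dtau r1 mrest1 ler01.
have all := HK_upper_add hd dX dtau (HK_upper_add hd dX dtau pairs
  (HK_upper_add hd dX dtau left0 left1)) (HK_upper_add hd dX dtau far0 far1).
have fin0 E i : measurable E -> mu0 (E `&` A i) \is a fin_num.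
  by move=> mE; rewrite fin_num_measure//; exact: measurableI.
have fin1 E j : measurable E -> mu1 (E `&` B j) \is a fin_num.
  by move=> mE; rewrite fin_num_measure//; exact: measurableI.
apply: (HK_upper_eq all) => [E mE|E mE|].
- rewrite (cells_decomposition mu0 mA tA mE) /= big1_eq !adde0 mul1e.
  by rewrite (marginal_recombine m0 (fun i => fin0 E i mE)).
- rewrite (cells_decomposition mu1 mB tB mE) /= big1_eq !add0e mul1e exchange_big/=.
  by rewrite (marginal_recombine n0 (fun j => fin1 E j mE)).
- rewrite (total_mass_cells mu0 mA tA) (total_mass_cells mu1 mB tB) !mul1r.
  rewrite [X in _ + (X + _) + _](eq_bigr (fun i => m i - \sum_j a i j)); last first.
    by move=> i _; rewrite divfK// gt_eqF.
  rewrite [X in _ + (_ + X) + _](eq_bigr (fun j => n j - \sum_i b i j)); last first.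
    by move=> j _; rewrite divfK// gt_eqF.
  have split i : \sum_j (a i j + b i j - 2 * (gamma i j * Num.sqrt (a i j * b i j))) =
      \sum_j a i j + \sum_j b i j - 2 * \sum_j gamma i j * Num.sqrt (a i j * b i j).
    by rewrite sumrB big_split/= -mulr_sumr.
  rewrite (eq_bigr _ (fun i _ => split i)) !sumrB big_split/= -mulr_sumr.
  rewrite [X in _ + X - _]exchange_big/=.
  set s1 := \sum_i \sum_j a i j; set s2 := \sum_j \sum_i b i j; lra.
Qed.

End primal.

Section dual.
Context {x : I -> X} {y : J -> X} {delta kappa : R} {u : I -> R} {v : J -> R}.
Hypothesis delta0 : 0 < delta.
Hypothesis kappa0 : 0 < kappa.
Hypothesis kappa1 : kappa <= 1.
Hypothesis Ax : forall i, A i `<=` dball d (x i) delta.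
Hypothesis By : forall j, B j `<=` dball d (y j) delta.
Hypothesis v0 : forall j, 0 < v j.
Hypothesis uv : forall i j,
  tcos (rdist d (x i) (y j) - 2 * delta) ^+ 2 <= u i * v j.

Local Notation xi := (dual_potential (d := d) (x := x) (y := y) (delta := delta)
  (kappa := kappa) (v := v)).

(** The functional is affine in [1 + 2 xi] and [1 - 2 P1 xi], which are bounded
    by the finite solution on the cells and by [kappa^-1] elsewhere. *)
Lemma dual_value :
  ((1 / 2 * (total - (\sum_i m i * Num.max (u i) kappa + kappa^-1 * rest0)
     - (\sum_j n j * Num.max (v j) kappa + kappa^-1 * rest1)))%:E
   <= \int[mu1]_x P1 d xi x - \int[mu0]_x (xi x)%:E)%E.
Proof.
have k1 : 1 <= kappa^-1 by rewrite invf_ge1.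
have klb z : kappa <= 1 + 2 * xi z := dual_potential_lbound z.
have kub z : 1 + 2 * xi z <= kappa^-1.
  by rewrite dual_potentialK; exact: dual_weight_le.
have plb z : 0 <= 1 - 2 * P1_real (d := d) xi z := dual_P1_ge0 hd kappa0 z.
have pub z : 1 - 2 * P1_real (d := d) xi z <= kappa^-1 := dual_P1_le hd kappa0 z.
have [xiL _] := dual_potential_Lip_bs hd dX (x := x) (y := y) delta0 kappa0 kappa1 v0.
have mxi := Lip_b_borel hd dX dtau xiL.
have mP := Lip_b_borel hd dX dtau (P1_real_Lip_b hd kappa0 klb).
have xib z : `|xi z| <= kappa^-1.
  by have := klb z; have := kub z; move: kappa0; rewrite ler_norml; lra.
have Pb z : `|P1_real (d := d) xi z| <= kappa^-1.
  by have := plb z; have := pub z; rewrite ler_norml; lra.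
have [I0 f0] := integral_affine mu0 1 2 mxi xib.
have [I1 f1] := integral_affine mu1 1 (- 2) mP Pb.
have le0 : (\int[mu0]_z (1 + 2 * xi z)%:E <=
    (\sum_i m i * Num.max (u i) kappa + kappa^-1 * rest0)%:E)%E.
  apply: integral_cells_le => //.
  - apply: measurable_funD; first exact: measurable_cst.
    by apply: measurable_funM; first exact: measurable_cst.
  - by move=> z; apply: le_trans (klb z); exact: ltW.
  - by move=> i; rewrite le_max (ltW kappa0) orbT.
  - by rewrite (le_trans ler01).
  - by move=> i z Az; rewrite dual_potentialK; exact: (dual_weight_cell hd dX kappa0 Ax v0 uv Az).
have le1 : (\int[mu1]_z (1 + - 2 * P1_real (d := d) xi z)%:E <=
    (\sum_j n j * Num.max (v j) kappa + kappa^-1 * rest1)%:E)%E.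
  apply: integral_cells_le => //.
  - apply: measurable_funD; first exact: measurable_cst.
    by apply: measurable_funM; first exact: measurable_cst.
  - by move=> z; rewrite mulNr.
  - by move=> i; rewrite le_max (ltW kappa0) orbT.
  - by rewrite (le_trans ler01).
  - by move=> i z Bz; rewrite mulNr; exact: (dual_P1_cell hd dX kappa0 By v0 Bz).
  - by move=> z; rewrite mulNr.
rewrite I0 lee_fin in le0; rewrite I1 lee_fin in le1.
have -> : (\int[mu1]_z P1 d xi z = \int[mu1]_z (P1_real (d := d) xi z)%:E)%E.
  by apply: eq_integral => z _; exact: (P1_realE hd kappa0 klb).
rewrite -(fineK f0) -(fineK f1) -EFinB lee_fin.
lra.
Qed.

End dual.

End strong_duality.

(** Four errors of at most [eta / 4] each: the diameter of the cells, the floor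
    [kappa], the gap of the finite problem and the mass outside the cells. *)
Lemma gap_bookkeeping {R : realType} (T S Q delta kappa eta U V M N U' V' r s : R) :
  0 <= delta -> 0 <= kappa -> delta * (T + 1) = eta / 8 -> kappa * (T + 1) <= eta / 2 ->
  delta * (2 * Q) <= delta * T -> kappa * M + kappa * N <= kappa * T ->
  U' <= U + kappa * M -> V' <= V + kappa * N -> U + V <= 2 * S + eta / 2 ->
  r <= eta / 4 -> s <= eta / 4 ->
  1 / 2 * (T - 2 * (S - 4 * delta * Q)) <= 1 / 2 * (T - (U' + r) - (V' + s)) + eta.
Proof. lra. Qed.

Section duality.
Context {R : realType} {X : ptopologicalType} {d : X -> X -> \bar R}.
Hypothesis hd : ext_metric_topological d.
Hypothesis dX : separable_metric d.
Hypothesis dtau : induced_by d.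
Context {mu0 mu1 : {finite_measure set (borel X) -> \bar R}}.
Hypothesis r0 : radon mu0.
Hypothesis r1 : radon mu1.

(** Both values are compared through the finite problem whose coefficients
    are the cosines at the centres of the cells, at a distance shortened by the
    diameter. The dual side needs exactly these overestimated cosines, whereas on
    the primal side they exceed the true ones by at most [4 delta]. *)
Lemma duality_gap (eta : R) : 0 < eta -> exists xi : X -> R,
  [/\ Lip_bs d xi, ((- (1 / 2))%:E < ereal_inf (range (EFin \o xi)))%E &
   ((1 / 2)%:E * HK2 d mu0 mu1 <=
    \int[mu1]_x P1 d xi x - \int[mu0]_x (xi x)%:E + eta%:E)%E].
Proof.
move=> eta0; pose T := fine (mu0 setT) + fine (mu1 setT).
have T0 : 0 <= T by rewrite addr_ge0 ?fine_ge0.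
have T1 : 0 < T + 1 by rewrite ltr_wpDl.
(* Adding [1] to the total mass avoids a division by zero. *)
pose delta := eta / (8 * (T + 1)).
pose kappa := Num.min 1 (eta / (2 * (T + 1))).
have delta0 : 0 < delta by rewrite divr_gt0 ?mulr_gt0.
have kappa0 : 0 < kappa by rewrite lt_min ltr01 divr_gt0 ?mulr_gt0.
have kappa1 : kappa <= 1 by rewrite ge_min lexx.
have e0 : 0 < kappa * eta / 4 by rewrite divr_gt0 ?mulr_gt0.
have [I [A [x [mA tA A0 Ax RA]]]] := cells_exist hd dX dtau mu0 delta0 e0.
have [J [B [y [mB tB B0 By RB]]]] := cells_exist hd dX dtau mu1 delta0 e0.
pose m i := fine (mu0 (A i)); pose n j := fine (mu1 (B j)).
have m0 i : 0 < m i by rewrite fine_gt0// A0/= ltey_eq fin_num_measure.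
have n0 j : 0 < n j by rewrite fine_gt0// B0/= ltey_eq fin_num_measure.
pose c i j := tcos (rdist d (x i) (y j) - 2 * delta).
have c0 i j : 0 <= c i j := tcos_ge0 _.
have eta2 : 0 < eta / 2 by rewrite divr_gt0.
have [u [v [a [b [[u0 v0] uv [a0 b0] [am bn] gap]]]]] := finite_duality m0 n0 c0 eta2.
pose xi : X -> R := dual_potential (d := d) (x := x) (y := y) (delta := delta)
  (kappa := kappa) (v := v).
exists xi; split.
- exact: dual_potential_Lip_bs.
- by apply: (lbound_inf_gt kappa0) => z; exact: dual_potential_lbound.
have dual := dual_value (mu0 := mu0) (mu1 := mu1) hd dX dtau mA mB
  delta0 kappa0 kappa1 Ax By v0 uv.
have primal : (HK2 d mu0 mu1 <=
   (T - 2 * \sum_i \sum_j (c i j - 4 * delta) * Num.sqrt (a i j * b i j))%:E)%E.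
  apply: (HK2_le_cells hd dX dtau r0 r1 mA mB tA tB A0 B0 a0 b0 am bn).
    by move=> i j; have := tcos_le1 (rdist d (x i) (y j) - 2 * delta); rewrite /c; lra.
  move=> i j z w /Ax xz /By yw; apply: le_trans (tcos_le_cos hd dX z w).
  move: xz yw; rewrite /dball /= !(rdistE hd dX) !lte_fin => xz yw.
  apply: (@le_trans _ _ (tcos (rdist d (x i) (y j) + 2 * delta))).
    have := tcos_lipschitz (rdist d (x i) (y j) - 2 * delta) (rdist d (x i) (y j) + 2 * delta).
    rewrite ler_norml => /andP[_]; rewrite /c ler0_norm; lra.
  apply: tcos_antitone.
  have := rdist_triangle hd dX z (x i) w; have := rdist_triangle hd dX (x i) (y j) w.
  rewrite (rdist_sym hd z (x i)); lra.
have massA : fine (mu0 setT) = _ := total_mass_cells mu0 mA tA.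
have massB : fine (mu1 setT) = _ := total_mass_cells mu1 mB tB.
move: massA massB dual; rewrite -/m -/n.
set rA := fine (mu0 (~` _)); set rB := fine (mu1 (~` _)).
move=> massA massB dual.
have mR0 : measurable (~` \bigcup_i A i) by apply: measurableC; exact: fin_bigcup_measurable.
have mR1 : measurable (~` \bigcup_j B j) by apply: measurableC; exact: fin_bigcup_measurable.
have rA0 : 0 <= rA by rewrite fine_ge0.
have rB0 : 0 <= rB by rewrite fine_ge0.
have rAe : rA < kappa * eta / 4 by rewrite -lte_fin fineK ?fin_num_measure.
have rBe : rB < kappa * eta / 4 by rewrite -lte_fin fineK ?fin_num_measure.
pose S := \sum_i \sum_j c i j * Num.sqrt (a i j * b i j).
pose Q := \sum_i \sum_j Num.sqrt (a i j * b i j).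
have SE : \sum_i \sum_j (c i j - 4 * delta) * Num.sqrt (a i j * b i j) = S - 4 * delta * Q.
  rewrite /S /Q mulr_sumr -sumrB; apply: eq_bigr => i _.
  by rewrite mulr_sumr -sumrB; apply: eq_bigr => j _; rewrite mulrBl.
have Q2 : 2 * Q <= T.
  apply: (@le_trans _ _ (\sum_i \sum_j (a i j + b i j))).
    rewrite mulr_sumr; apply: ler_sum => i _; rewrite mulr_sumr; apply: ler_sum => j _.
    have := sqr_ge0 (Num.sqrt (a i j) - Num.sqrt (b i j)).
    by rewrite sqrrB !sqr_sqrtr// sqrtrM//; lra.
  under eq_bigr do rewrite big_split/=.
  rewrite big_split/= [X in _ + X]exchange_big/=.
  have sa : \sum_i \sum_j a i j <= \sum_i m i by apply: ler_sum => i _; exact: am.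
  have sb : \sum_j \sum_i b i j <= \sum_j n j by apply: ler_sum => j _; exact: bn.
  rewrite /T massA massB; apply: lerD.
    by apply: (le_trans sa); rewrite lerDl.
  by apply: (le_trans sb); rewrite lerDl.
have maxu : \sum_i m i * Num.max (u i) kappa <= \sum_i m i * u i + kappa * \sum_i m i.
  rewrite mulr_sumr -big_split/=; apply: ler_sum => i _.
  rewrite [kappa * _]mulrC -mulrDr ler_wpM2l ?(ltW (m0 i))//.
  by rewrite ge_max lerDl (ltW kappa0) lerDr (ltW (u0 i)).
have maxv : \sum_j n j * Num.max (v j) kappa <= \sum_j n j * v j + kappa * \sum_j n j.
  rewrite mulr_sumr -big_split/=; apply: ler_sum => i _.
  rewrite [kappa * _]mulrC -mulrDr ler_wpM2l ?(ltW (n0 i))//.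
  by rewrite ge_max lerDl (ltW kappa0) lerDr (ltW (v0 i)).
apply: (@le_trans _ _ ((1 / 2 * (T - 2 * (S - 4 * delta * Q)))%:E)%E).
  by rewrite -SE [X in (_ <= X)%E]EFinM lee_wpmul2l// lee_fin; lra.
apply: le_trans (leeD dual (lexx eta%:E)); rewrite -EFinD lee_fin.
have kA : kappa^-1 * rA <= eta / 4.
  by rewrite mulrC ler_pdivrMr// (le_trans (ltW rAe))// [kappa * _]mulrC mulrAC.
have kB : kappa^-1 * rB <= eta / 4.
  by rewrite mulrC ler_pdivrMr// (le_trans (ltW rBe))// [kappa * _]mulrC mulrAC.
have dT : delta * (T + 1) = eta / 8.
  by rewrite /delta invfM mulrA mulfVK ?gt_eqF.
have kT : kappa * (T + 1) <= eta / 2.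
  by rewrite -ler_pdivlMr// ge_min [eta / 2 / _]mulrAC -mulrA -invfM [(T + 1) * _]mulrC lexx orbT.
have dQ : delta * (2 * Q) <= delta * T by rewrite ler_wpM2l// ltW.
have kM : kappa * \sum_i m i + kappa * \sum_j n j <= kappa * T.
  by rewrite -mulrDr ler_wpM2l ?(ltW kappa0)// /T massA massB; lra.
exact: (gap_bookkeeping (ltW delta0) (ltW kappa0) dT kT dQ kM maxu maxv gap kA kB).
Qed.

Lemma strong_duality :
  ((1 / 2)%:E * HK2 d mu0 mu1 =
      ereal_sup [set \int[mu1]_x P1 d xi x - \int[mu0]_x (xi x)%:E |
        xi in [set xi : X -> R | Lip_bs d xi /\
          ((- (1 / 2))%:E < ereal_inf (range (EFin \o xi)))%E]])%E.
Proof.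
apply/eqP; rewrite eq_le; apply/andP; split; last first.
  apply: ge_ereal_sup => _ [xi [[xiL _] xi_inf] <-].
  exact: weak_duality.
apply/lee_addgt0Pr => eta /duality_gap[xi [xiL xi_inf le]].
apply: (le_trans le); rewrite leeD2r//; apply: ereal_sup_ubound.
by exists xi.
Qed.

End duality.

Theorem theorem7p21 (R : realType) (X : ptopologicalType)
    (d : X -> X -> \bar R) (hd : ext_metric_topological d) :
  (* the two expressions of P1 agree *)
  (forall xi : X -> R, borel_fun xi -> (forall x, - (1 / 2) < xi x) ->
    forall x, P1 d xi x = ereal_inf (range (fun x' =>
      (1 / 2 * (1 - cos (dtrunc d (pi / 2) x x') ^+ 2 / (1 + 2 * xi x')))%:E)))
  /\
  (* (i) *)
  (forall xi : X -> R, borel_fun xi -> bounded_fun xi ->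
    ((- (1 / 2))%:E < ereal_inf (range (EFin \o xi)))%E ->
    [/\ (exists2 f : X -> R, Lip_b d f & forall x, P1 d xi x = (f x)%:E),
        (ereal_sup (range (P1 d xi)) < (1 / 2)%:E)%E,
        (forall x, P1 d xi x = ereal_inf ((fun x' =>
          (1 / 2 * (1 - cos (dtrunc d (pi / 2) x x') ^+ 2
                        / (1 + 2 * xi x')))%:E) @` dball d x (pi / 2))) &
        (bounded_support d xi ->
          exists2 f : X -> R, Lip_bs d f & forall x, P1 d xi x = (f x)%:E)])
  /\
  (* (ii) *)
  (separable_metric d -> induced_by d ->
    forall mu0 mu1 : {finite_measure set (borel X) -> \bar R},
    radon mu0 -> radon mu1 ->
    ((1 / 2)%:E * HK2 d mu0 mu1 =
      ereal_sup [set \int[mu1]_x P1 d xi x - \int[mu0]_x (xi x)%:E |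
        xi in [set xi : X -> R | Lip_bs d xi /\
          ((- (1 / 2))%:E < ereal_inf (range (EFin \o xi)))%E]])%E).
Proof.
split=> [xi _|]; first exact: P1E.
split=> [xi _|dX dtau mu0 mu1 r0 r1]; first exact: P1_regularity.
exact: strong_duality.
Qed.
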